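(* Let $(M,g)$ be an oriented Riemannian $3$-manifold. If there is a Killing field $X$ such that $\omega=\mathrm{curl}\,X$ is also Killing, and $X,\omega$ are linearly independent in some neighborhood, then there exist local oriented coordinates $(r,\theta,z)$, a constant $c$ and a positive function $\varphi$ such that the metric is given by $$ds^2=dr^2+\Big(\varphi(r)\,d\theta+\frac{c}{\varphi(r)}\,dz\Big)^2+\varphi'(r)^2\,dz^2$$ with $X=\partial_\theta$ and $\omega=2\,\partial_z$.
   Context: $\mathrm{curl}\,X=(\star\,dX^\flat)^\sharp$, with $\star$ the Hodge star. A vector field is Killing if its (local) flow acts by isometries, equivalently $g(\nabla_uX,v)+g(u,\nabla_vX)=0$ for all vector fields $u,v$. *)

(* Defs.v *)
From HB Require Import structures.
From mathcomp Require Export all_boot all_order all_algebra.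
From mathcomp Require Export all_classical all_reals all_analysis.
Export Order.TTheory GRing.Theory Num.Theory numFieldNormedType.Exports.

Set Implicit Arguments.
Unset Strict Implicit.
Unset Printing Implicit Defensive.

Local Open Scope classical_set_scope.
Local Open Scope ring_scope.

(* [A] is meant to be open and [V] finite-dimensional, so that [C_k k A f] says
   that [f] is of class C^k on [A]; the values of [f] off [A] are irrelevant. *)
Fixpoint C_k (R : realType) (V W : normedModType R) (k : nat) (A : set V)
    (f : V -> W) : Prop :=
  if k is k'.+1 then
    (forall x, A x -> differentiable f x) /\
    (forall v, C_k k' A (fun x => 'D_v f x))
  else forall x, A x -> {for x, continuous f}.

Definition smooth_on (R : realType) (V W : normedModType R) (A : set V)
    (f : V -> W) : Prop :=
  forall k, C_k k A f.

(* Only the restriction of [coord] to [chart_dom] and of [param] to [chart_img]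
   matter: off these sets the two functions take arbitrary values. *)
Record chart (R : realType) (M : topologicalType) := Chart {
  chart_dom : set M;
  coord : M -> 'rV[R]_3;
  param : 'rV[R]_3 -> M;
  chart_img : set 'rV[R]_3 := coord @` chart_dom;
  chart_dom_open : open chart_dom;
  chart_img_open : open chart_img;
  coordK : forall p, chart_dom p -> param (coord p) = p;
  coord_continuous : {within chart_dom, continuous coord};
  param_continuous : {within chart_img, continuous param} }.

Definition transition (R : realType) (M : topologicalType) (c c' : chart R M) :
    'rV[R]_3 -> 'rV[R]_3 :=
  coord c' \o param c.

(* With the library's row-vector convention, a tangent vector with components
   [v] in [c] has components [v *m jac c c' p] in [c']. *)
Definition jac (R : realType) (M : topologicalType) (c c' : chart R M) (p : M) :
    'M[R]_3 :=
  jacobian (transition c c') (coord c p).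

Definition oriented_compatible (R : realType) (M : topologicalType)
    (c c' : chart R M) : Prop :=
  smooth_on (coord c @` (chart_dom c `&` chart_dom c')) (transition c c') /\
  forall p, chart_dom c p -> chart_dom c' p -> 0 < \det (jac c c' p).

(* Smooth structure and orientation together are a maximal oriented atlas, so
   that the members of [atlas] are all the local oriented coordinate systems. *)
Record oriented_3manifold (R : realType) := Oriented3Manifold {
  manifold_carrier :> topologicalType;
  manifold_hausdorff : hausdorff_space manifold_carrier;
  manifold_second_countable : @second_countable manifold_carrier;
  atlas : set (chart R manifold_carrier);
  atlas_cover : forall p : manifold_carrier,
    exists2 c, atlas c & chart_dom c p;
  atlas_compatible : forall c c', atlas c -> atlas c' ->
    oriented_compatible c c';
  atlas_maximal : forall c,
    (forall c', atlas c' ->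
       oriented_compatible c c' /\ oriented_compatible c' c) ->
    atlas c }.

(* Tensor fields are given by their components in the charts of the atlas;
   [X c p] is relevant only for [c] in the atlas and [p] in [chart_dom c]. *)
Definition vfield_comp (R : realType) (M : oriented_3manifold R) :=
  chart R M -> M -> 'rV[R]_3.

Definition tensor2_comp (R : realType) (M : oriented_3manifold R) :=
  chart R M -> M -> 'M[R]_3.

Definition vector_field (R : realType) (M : oriented_3manifold R)
    (X : vfield_comp M) : Prop :=
  (forall c c' p, atlas c -> atlas c' -> chart_dom c p -> chart_dom c' p ->
     X c' p = X c p *m jac c c' p) /\
  (forall c, atlas c -> smooth_on (chart_img c) (X c \o param c)).

Definition inner (R : realType) (M : oriented_3manifold R) (g : tensor2_comp M)
    (c : chart R M) (p : M) (u v : 'rV[R]_3) : R :=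
  (u *m g c p *m v^T) 0 0.

Definition riemannian_metric (R : realType) (M : oriented_3manifold R)
    (g : tensor2_comp M) : Prop :=
  [/\ forall c c' p, atlas c -> atlas c' -> chart_dom c p -> chart_dom c' p ->
        g c p = jac c c' p *m g c' p *m (jac c c' p)^T,
      forall c, atlas c -> smooth_on (chart_img c) (g c \o param c),
      forall c p, atlas c -> chart_dom c p -> (g c p)^T = g c p
    & forall c p, atlas c -> chart_dom c p ->
        forall v, v != 0 -> 0 < inner g c p v v].

Section Calculus.
Variables (R : realType) (M : oriented_3manifold R).
Implicit Types (g : tensor2_comp M) (X : vfield_comp M) (c : chart R M) (p : M).

Definition basis_vec (i : 'I_3) : 'rV[R]_3 := delta_mx 0 i.

Definition pderiv c (i : 'I_3) (f : M -> R) (p : M) : R :=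
  'D_(basis_vec i) (f \o param c) (coord c p).

(* [christoffel g c p k i j] is $\Gamma^k_{ij}$ *)
Definition christoffel g c p (k i j : 'I_3) : R :=
  2^-1 * \sum_(l < 3) invmx (g c p) k l *
    (pderiv c i (fun q => g c q j l) p + pderiv c j (fun q => g c q i l) p
     - pderiv c l (fun q => g c q i j) p).

(* $\nabla_u X$ at [p], for the Levi-Civita connection and [u] tangent at [p] *)
Definition nabla g X c p (u : 'rV[R]_3) : 'rV[R]_3 :=
  \row_(k < 3) \sum_(i < 3) u 0 i *
    (pderiv c i (fun q => X c q 0 k) p
     + \sum_(j < 3) christoffel g c p k i j * X c p 0 j).

(* Both terms depend on the fields $u, v$ only through their values at [p], so
   the condition is imposed on all tangent vectors at all points. *)
Definition killing g X : Prop :=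
  vector_field X /\
  forall c p, atlas c -> chart_dom c p -> forall u v : 'rV[R]_3,
    inner g c p (nabla g X c p u) v + inner g c p u (nabla g X c p v) = 0.

Definition flat g X : vfield_comp M := fun c p => X c p *m g c p.

Definition sharp g (a : vfield_comp M) : vfield_comp M :=
  fun c p => a c p *m invmx (g c p).

(* A 2-form $\beta$ is the antisymmetric matrix of the
   $\beta(\partial_j,\partial_k)$. *)
Definition ext_deriv (a : vfield_comp M) : tensor2_comp M :=
  fun c p => \matrix_(j < 3, k < 3)
    (pderiv c j (fun q => a c q 0 k) p - pderiv c k (fun q => a c q 0 j) p).

Definition volume_form g c p (u v w : 'rV[R]_3) : R :=
  Num.sqrt (\det (g c p)) * \det (col_mx u (col_mx v w) : 'M[R]_3).

(* $(\star\beta)_i = \frac12 \beta^{jk}\,\mathrm{vol}_{jki}$, the indices of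
   $\beta$ being raised with the inverse metric *)
Definition hodge_star2 g (b : tensor2_comp M) : vfield_comp M :=
  fun c p => \row_(i < 3) (2^-1 * \sum_(j < 3) \sum_(k < 3)
    (invmx (g c p) *m b c p *m (invmx (g c p))^T) j k *
    volume_form g c p (basis_vec j) (basis_vec k) (basis_vec i)).

Definition curl g X : vfield_comp M :=
  sharp g (hodge_star2 g (ext_deriv (flat g X))).

End Calculus.

(* Main.v *)
(* Put Z = curl X / 2 and f = |X|^2 / 2. Since X is Killing, df = vol (., X, Z), so that X and Z
   are tangent to the level sets of f and the gradient n of f is orthogonal to both. As L_X and
   L_Z annihilate the metric and f, they annihilate n, hence also |n|^2, which is the Gram
   determinant of (X, Z); differentiating the latter gives [X, Z] = 0. Thus N = n / |n|, X and Z
   commute, and their dual coframe is closed: its primitives r, theta, z, which exist by the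
   Poincare lemma, are coordinates by the inverse function theorem. In these coordinates the
   metric is dr^2 + |X|^2 dtheta^2 + 2 <X, Z> dtheta dz + |Z|^2 dz^2. Here |X|^2 depends on r
   only, with N |X|^2 = 2 |n|, and <X, Z> is a constant c because
   d X^flat (N, Z) = vol (2 Z, N, Z) = 0. So phi = |X| satisfies
   (phi phi')^2 = |n|^2 = phi^2 |Z|^2 - c^2, which is the asserted form. *)

(* No flow occurs. In a fixed chart the Killing condition becomes the vanishing of the Lie
   derivative of the metric, a first-order identity between matrix-valued functions on an open set
   of R^3. It yields D_Y <P, Q> = <[Y, P], Q> + <P, [Y, Q]>, and every invariance statement is drawn
   from this rule. The curl is halved because omega must become 2 d/dz; then n is exactly the cross
   product of X and Z, which is why |n|^2 is their Gram determinant. Linear independence makes that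
   determinant positive, so n can be normalised, and the invariance of |n| lets N still commute with
   X and Z. Orientation costs nothing: vol (N, X, Z) = |n| > 0. The new coordinates belong to the
   atlas by its maximality, so only their transitions with the given charts have to be examined. *)
From HB Require Import structures.
From mathcomp Require Import ring lra.
Require Import Defs.

Set Implicit Arguments.
Unset Strict Implicit.
Unset Printing Implicit Defensive.

Local Open Scope classical_set_scope.
Local Open Scope ring_scope.

(** * Closure properties of C^k maps *)

Section Ck.
Variables (R : realType) (V : normedModType R).
Implicit Types (A B : set V).

Lemma near_eq_differentiable (W : normedModType R) (f g : V -> W) (x : V) :
  {near x, f =1 g} -> differentiable f x -> differentiable g x.
Proof.
move=> fg dfx; have [cdf fE] := (diff_locallyP _ _).1 dfx.
have E : g \o shift x = cst (g x) + 'd f x +o_ 0 id.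
  apply/eqaddoP => e e0; have /eqaddoP/(_ e e0) := fE.
  have : \forall y \near (0 : V), f (y + x) = g (y + x).
    by move: fg; rewrite (near_shift 0 x); apply: filterS => y /=; rewrite subr0.
  apply: filterS2 => y /= E; rewrite !fctE /= E /cst.
  by rewrite (nbhs_singleton fg).
by apply/diff_locallyP; rewrite (diff_unique cdf E).
Qed.

(** A derivative depends on the germ only, and [A] is open, so equality on [A] is equality near each
    of its points. This lemma carries every computed derivative formula back to the function it came
    from. *)
Lemma C_k_ext (W : normedModType R) k A (f g : V -> W) : open A ->
  (forall x, A x -> f x = g x) -> C_k k A f -> C_k k A g.
Proof.
move=> oA; elim: k f g => [|k IH] f g fg.
all: have nfg x : A x -> {near x, f =1 g}
  by move=> Ax; have := open_nbhs_nbhs (conj oA Ax); apply: filterS => y /fg.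
  move=> cf x Ax; rewrite /prop_for /continuous_at -(fg x Ax).
  by apply: cvg_trans (cf x Ax); apply: near_eq_cvg; apply: filterS (nfg x Ax) => y ->.
move=> [df cf]; split=> [x Ax|v].
  exact: near_eq_differentiable (nfg x Ax) (df x Ax).
by apply: (IH (fun x => 'D_v f x)) (cf v) => x Ax; exact/near_eq_derive/nfg.
Qed.

Lemma C_kW (W : normedModType R) k A (f : V -> W) : C_k k.+1 A f -> C_k k A f.
Proof.
elim: k f => [|k IH] f; first by move=> [df _] x /df; exact: differentiable_continuous.
by move=> [df cf]; split=> // v; apply: IH; exact: cf.
Qed.

Lemma C_k_sub (W : normedModType R) k A B (f : V -> W) :
  A `<=` B -> C_k k B f -> C_k k A f.
Proof.
move=> AB; elim: k f => [|k IH] f /=; first by move=> cf x /AB/cf.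
by move=> [df cf]; split=> [x /AB/df//|v]; exact: IH.
Qed.

Lemma C_k_cst (W : normedModType R) k A (w : W) : C_k k A (fun=> w).
Proof.
elim: k w => [|k IH] w /=; first by move=> x _; exact: cst_continuous.
split=> [x _|v]; first exact: differentiable_cst.
by rewrite (_ : 'D_v _ = fun=> 0) //; apply/funext => x; rewrite derive_cst.
Qed.

Lemma C_kD (W : normedModType R) k A (f g : V -> W) : open A ->
  C_k k A f -> C_k k A g -> C_k k A (fun x => f x + g x).
Proof.
move=> oA; elim: k f g => [|k IH] f g /=.
  by move=> cf cg x Ax; apply: continuousD; [exact: cf|exact: cg].
move=> [df cf] [dg cg]; split=> [x Ax|v].
  by apply: differentiableD; [exact: df|exact: dg].
apply: (C_k_ext oA) (IH _ _ (cf v) (cg v)) => x Ax.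
by rewrite [RHS]deriveD //; apply: diff_derivable; [exact: df|exact: dg].
Qed.

Lemma C_k_sum (W : normedModType R) k A (I : Type) (r : seq I) (P : pred I)
    (f : I -> V -> W) : open A ->
  (forall i, P i -> C_k k A (f i)) -> C_k k A (fun x => \sum_(i <- r | P i) f i x).
Proof.
move=> oA cf; elim: r => [|i r IH].
  by apply: (C_k_ext oA) (C_k_cst k A 0) => x _; rewrite big_nil.
case Pi: (P i); last first.
  by apply: (C_k_ext oA) IH => x _; rewrite big_cons Pi.
by apply: (C_k_ext oA) (C_kD oA (cf i Pi) IH) => x _; rewrite big_cons Pi.
Qed.

Lemma C_kM k A (f g : V -> R) : open A ->
  C_k k A f -> C_k k A g -> C_k k A (fun x => f x * g x).
Proof.
move=> oA; elim: k f g => [|k IH] f g.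
  by move=> cf cg x Ax; apply: continuousM; [exact: cf|exact: cg].
move=> Cf Cg; have [df cf] := Cf; have [dg cg] := Cg; split=> [x Ax|v].
  by apply: differentiableM; [exact: df|exact: dg].
apply: (C_k_ext oA) (C_kD oA (IH _ _ (C_kW Cf) (cg v)) (IH _ _ (C_kW Cg) (cf v))).
move=> x Ax; rewrite [RHS]deriveM //; apply: diff_derivable; [exact: df|exact: dg].
Qed.

Lemma C_kN k A (f : V -> R) : open A ->
  C_k k A f -> C_k k A (fun x => - f x).
Proof.
move=> oA cf; apply: (C_k_ext oA) (C_kM oA (C_k_cst k A (-1 : R)) cf) => x _.
by rewrite mulN1r.
Qed.

Lemma C_k_prod k A (I : Type) (r : seq I) (P : pred I)
    (f : I -> V -> R) : open A ->
  (forall i, P i -> C_k k A (f i)) -> C_k k A (fun x => \prod_(i <- r | P i) f i x).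
Proof.
move=> oA cf; elim: r => [|i r IH].
  by apply: (C_k_ext oA) (C_k_cst k A (1 : R)) => x _; rewrite big_nil.
case Pi: (P i); last first.
  by apply: (C_k_ext oA) IH => x _; rewrite big_cons Pi.
by apply: (C_k_ext oA) (C_kM oA (cf i Pi) IH) => x _; rewrite big_cons Pi.
Qed.

(** The derivative of 1/f is a product containing 1/f twice and no higher-order data, so the
    statement at order [k] feeds itself at order [k.+1]. The square root below follows the same
    recursion. *)
Lemma C_kV k A (f : V -> R) : open A -> (forall x, A x -> f x != 0) ->
  C_k k A f -> C_k k A (fun x => (f x)^-1).
Proof.
move=> oA f0; elim: k => [|k IH].
  by move=> cf x Ax; apply: continuousV; [exact: f0|exact: cf].
move=> Cf; have [df cf] := Cf; split=> [x Ax|v].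
  by apply: differentiableV; [exact: df|exact: f0].
have CV := IH (C_kW Cf).
apply: (C_k_ext oA) (C_kN oA (C_kM oA (C_kM oA CV CV) (cf v))).
move=> x Ax; rewrite [RHS]deriveV ?f0 //; last by apply/diff_derivable/df.
by rewrite expr2 invfM scaleNr.
Qed.

Lemma C_k_sqrt k A (f : V -> R) : open A -> (forall x, A x -> 0 < f x) ->
  C_k k A f -> C_k k A (fun x => Num.sqrt (f x)).
Proof.
move=> oA f0; elim: k => [|k IH].
  by move=> cf x Ax; apply: continuous_comp; [exact: cf|exact: sqrt_continuous].
move=> Cf; have [df cf] := Cf.
have dS x : A x -> is_derive (f x) 1 Num.sqrt (2 * Num.sqrt (f x))^-1.
  by move=> Ax; exact: is_derive1_sqrt (f0 x Ax).
have dsf x : A x -> differentiable (fun x => Num.sqrt (f x)) x.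
  move=> Ax; apply: (@differentiable_comp _ _ _ _ f Num.sqrt); first exact: df.
  by apply/derivable1_diffP; case: (dS x Ax).
split=> //v.
have CS := IH (C_kW Cf).
apply: (C_k_ext oA) (C_kM oA (C_kV oA _ (C_kM oA (C_k_cst k A (2 : R)) CS)) (cf v)).
  move=> x Ax; have dfx := df x Ax.
  have dsx : differentiable (Num.sqrt : R -> R) (f x).
    by apply/derivable1_diffP; case: (dS x Ax).
  rewrite [in RHS]deriveE; last exact: dsf.
  rewrite (@diff_comp _ _ _ _ f Num.sqrt) //= deriveE //.
  by rewrite (diff1E dsx) derive1E (@derive_val _ _ _ _ _ _ _ (dS x Ax)) mulrC.
by move=> x Ax; rewrite mulf_neq0 // sqrtr_eq0 -ltNge f0.
Qed.

Lemma differentiable_mx m n (f : V -> 'M[R]_(m, n)) x :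
  (forall i j, differentiable (fun x => f x i j) x) -> differentiable f x.
Proof.
move=> df.
have -> : f = fun x => \sum_(ij : 'I_m * 'I_n) f x ij.1 ij.2 *: delta_mx ij.1 ij.2.
  apply/funext => y; rewrite [LHS]matrix_sum_delta.
  by rewrite pair_big.
suff dsum (r : seq ('I_m * 'I_n)) : differentiable
    (fun x => \sum_(ij <- r) f x ij.1 ij.2 *: (delta_mx ij.1 ij.2 : 'M[R]_(m, n))) x by exact: dsum.
elim: r => [|[i j] r IH].
  by under eq_fun do rewrite big_nil; exact: differentiable_cst.
under eq_fun do rewrite big_cons.
apply: (@differentiableD _ _ _ (fun x => f x i j *: (delta_mx i j : 'M[R]_(m, n)))) IH.
by apply: differentiableZl; exact: df.
Qed.

Lemma differentiable_entry m n (f : V -> 'M[R]_(m, n)) x i j :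
  differentiable f x -> differentiable (fun x => f x i j) x.
Proof.
move=> df; apply: (@differentiable_comp _ _ _ _ f (fun N : 'M[R]_(m, n) => N i j)) => //.
exact: differentiable_coord.
Qed.

Lemma derive_entry m n (f : V -> 'M[R]_(m, n)) x v i j :
  derivable f x v -> ('D_v f x) i j = 'D_v (fun x => f x i j) x.
Proof. by move=> df; rewrite derive_mx // mxE. Qed.

Lemma continuous_mx m n (f : V -> 'M[R]_(m, n)) x :
  (forall i j, {for x, continuous (fun x => f x i j)}) -> {for x, continuous f}.
Proof.
move=> cf; apply/cvgrPdist_lt => e e0.
have : \forall y \near x, forall ij : 'I_m * 'I_n, `|f x ij.1 ij.2 - f y ij.1 ij.2| < e.
  by apply: filter_forall => ij; exact: ((cvgrPdist_lt _ _).1 (cf ij.1 ij.2)).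
apply: filterS => y fy; rewrite /Num.Def.normr/= mx_normrE bigmax_lt // => ij _.
by rewrite !mxE; exact: fy.
Qed.

Lemma continuous_entry m n (f : V -> 'M[R]_(m, n)) x i j :
  {for x, continuous f} -> {for x, continuous (fun x => f x i j)}.
Proof.
move=> cf; apply: (@continuous_comp _ _ _ f (fun N : 'M[R]_(m, n) => N i j)) => //.
exact: matrix_normedtype.coord_continuous.
Qed.

Lemma C_k_mxP k A m n (f : V -> 'M[R]_(m, n)) : open A ->
  C_k k A f <-> forall i j, C_k k A (fun x => f x i j).
Proof.
move=> oA; elim: k f => [|k IH] f.
  split=> cf; first by move=> i j x /cf; exact: continuous_entry.
  by move=> x Ax; apply: continuous_mx => i j; exact: cf.
split=> [[df cf] i j|cf].
  split=> [x /df|v]; first exact: differentiable_entry.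
  apply: (C_k_ext oA) ((IH _).1 (cf v) i j) => x Ax.
  by rewrite derive_entry //; exact/diff_derivable/df.
have df x : A x -> differentiable f x.
  by move=> Ax; apply: differentiable_mx => i j; case: (cf i j) => + _; exact.
split=> // v; apply/IH => i j; case: (cf i j) => _ /(_ v); apply: (C_k_ext oA) => x Ax.
by rewrite derive_entry //; exact/diff_derivable/df.
Qed.

Lemma C_k_mulmx k A m n p (f : V -> 'M[R]_(m, n)) (g : V -> 'M[R]_(n, p)) :
  open A -> C_k k A f -> C_k k A g -> C_k k A (fun x => f x *m g x).
Proof.
move=> oA /(C_k_mxP _ _ oA) cf /(C_k_mxP _ _ oA) cg; apply/(C_k_mxP _ _ oA) => i j.
apply: (C_k_ext oA) (_ : C_k k A (fun x => \sum_l f x i l * g x l j)).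
  by move=> x _; rewrite mxE.
by apply: C_k_sum => // l _; exact: C_kM.
Qed.

Lemma C_k_det k A n (f : V -> 'M[R]_n) : open A ->
  C_k k A f -> C_k k A (fun x => \det (f x)).
Proof.
move=> oA /(C_k_mxP _ _ oA) cf; rewrite /determinant.
apply: C_k_sum => // s _; apply: C_kM => //; first exact: C_k_cst.
by apply: C_k_prod => // i _; exact: cf.
Qed.

(** Cramer's formula: every entry of the inverse is a cofactor divided by the determinant. *)
Lemma C_k_invmx k A n (f : V -> 'M[R]_n) : open A ->
  (forall x, A x -> f x \in unitmx) -> C_k k A f -> C_k k A (fun x => invmx (f x)).
Proof.
move=> oA uf cf; apply/(C_k_mxP _ _ oA) => i j.
apply: (C_k_ext oA)
  (_ : C_k k A (fun x => (\det (f x))^-1 * ((-1) ^+ (j + i) * \det (row' j (col' i (f x)))))).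
  by move=> x Ax; rewrite /invmx uf // !mxE.
apply: C_kM => //.
  by apply: C_kV => //; [move=> x /uf; rewrite unitmxE unitfE|exact: C_k_det].
apply: C_kM => //; [exact: C_k_cst|apply: C_k_det => //].
apply/(C_k_mxP _ _ oA) => a b; move/(C_k_mxP _ _ oA): cf => /(_ (lift j a) (lift i b)).
by apply: C_k_ext => // x _; rewrite !mxE.
Qed.

Lemma derive_mulmx m n p (f : V -> 'M[R]_(m, n)) (g : V -> 'M[R]_(n, p)) x v :
  derivable f x v -> derivable g x v ->
  'D_v (fun x => f x *m g x) x = 'D_v f x *m g x + f x *m 'D_v g x.
Proof.
move=> df dg; have dfe := (derivable_mxP _ _ _).1 df; have dge := (derivable_mxP _ _ _).1 dg.
have E i j : (fun x => (f x *m g x) i j) =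
    \sum_l ((fun x => f x i l) * (fun x => g x l j)).
  by apply/funext => y; rewrite mxE fct_sumE.
have dM i j l : derivable ((fun x => f x i l) * (fun x => g x l j)) x v by exact: derivableM.
rewrite derive_mx; last by apply/derivable_mxP => i j; rewrite E; exact: derivable_sum.
apply/matrixP => i j; rewrite !mxE E derive_sum //.
rewrite -big_split /=; apply: eq_bigr => l _.
by rewrite deriveM // !derive_entry // addrC; congr (_ + _); rewrite mulrC.
Qed.

Lemma derivable_mulmx m n p (f : V -> 'M[R]_(m, n)) (g : V -> 'M[R]_(n, p)) x v :
  derivable f x v -> derivable g x v -> derivable (fun x => f x *m g x) x v.
Proof.
move=> /derivable_mxP df /derivable_mxP dg; apply/derivable_mxP => i j.
rewrite (_ : (fun x => _) = \sum_l ((fun x => f x i l) * (fun x => g x l j))).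
  by apply: derivable_sum => l; exact: derivableM.
by apply/funext => y; rewrite mxE fct_sumE.
Qed.

Lemma derivable_tr m n (f : V -> 'M[R]_(m, n)) x v :
  derivable f x v -> derivable (fun x => (f x)^T) x v.
Proof.
move=> /derivable_mxP df; apply/derivable_mxP => i j.
by rewrite (_ : (fun x => _) = fun x => f x j i) //; apply/funext => y; rewrite mxE.
Qed.

Lemma derive_tr m n (f : V -> 'M[R]_(m, n)) x v :
  derivable f x v -> 'D_v (fun x => (f x)^T) x = ('D_v f x)^T.
Proof.
move=> df; rewrite !derive_mx //; last exact: derivable_tr.
by apply/matrixP => i j; rewrite !mxE; congr ('D_v _ x); apply/funext => y; rewrite mxE.
Qed.

Lemma derive_mul (f h : V -> R) x v : derivable f x v -> derivable h x v ->
  'D_v (fun y => f y * h y) x = 'D_v f x * h x + f x * 'D_v h x.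
Proof. by move=> df dh; rewrite deriveM // addrC mulrC. Qed.

Lemma derivable_mul (f h : V -> R) x v : derivable f x v -> derivable h x v ->
  derivable (fun y => f y * h y) x v.
Proof. exact: derivableM. Qed.

Lemma derive_sub (f h : V -> R) x v : derivable f x v -> derivable h x v ->
  'D_v (fun y => f y - h y) x = 'D_v f x - 'D_v h x.
Proof. exact: deriveB. Qed.

Lemma derive_mulmx_tr n (f h : V -> 'rV[R]_n) x v :
  derivable f x v -> derivable h x v ->
  'D_v (fun y => (f y *m (h y)^T) 0 0) x =
  ('D_v f x *m (h x)^T) 0 0 + (f x *m ('D_v h x)^T) 0 0.
Proof.
move=> df dh; have dhT := derivable_tr dh.
rewrite -(derive_entry 0 0 (derivable_mulmx df dhT)) (derive_mulmx df dhT) mxE.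
by rewrite derive_tr.
Qed.

(** The chain rule differentiates [g] in the direction ['D_v f x], which moves with [x], while [C_k]
    speaks of fixed directions. Expanding over the standard basis restores fixed directions, with
    scalar coefficients of one order less. *)
Lemma C_k_comp k A n (f : V -> 'rV[R]_n.+1) (B : set 'rV[R]_n.+1) (g : 'rV[R]_n.+1 -> R) :
  open A -> open B -> (forall x, A x -> B (f x)) ->
  C_k k A f -> C_k k B g -> C_k k A (g \o f).
Proof.
move=> oA oB fAB; elim: k g => [|k IH] g.
  by move=> cf cg x Ax; apply: continuous_comp; [exact: cf|exact/cg/fAB].
move=> Cf [dg cg]; have [df cf] := Cf.
split=> [x Ax|v]; first by apply: differentiable_comp; [exact: df|exact/dg/fAB].
have Cfk := C_kW Cf.
apply: (C_k_ext oA) (_ : C_k k A (fun x =>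
   \sum_i ('D_v f x) 0 i * ('D_(delta_mx 0 i) g \o f) x)).
  move=> x Ax; rewrite [RHS]deriveE; last first.
    by apply: differentiable_comp; [exact: df|exact/dg/fAB].
  rewrite diff_comp /=; [|exact: df|exact/dg/fAB].
  rewrite -(deriveE _ (df x Ax)).
  rewrite [X in 'd g _ X]row_sum_delta linear_sum; apply: eq_bigr => i _.
  by rewrite linearZ /= -(deriveE _ (dg _ (fAB _ Ax))).
apply: C_k_sum => // i _; apply: C_kM => //; last exact: IH _ Cfk (cg _).
by have := cf v => /(C_k_mxP _ _ oA) /(_ 0 i).
Qed.

End Ck.

(** * Mean values along lines and symmetry of second derivatives *)

Section Lines.
Variables (R : realType) (V : normedModType R).

Lemma continuous_dist_lt (W : normedModType R) (f : V -> W) x e :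
  {for x, continuous f} -> 0 < e -> nbhs x [set y | `|f x - f y| < e].
Proof. by move=> cf e0; have := cf _ (nbhsx_ballx (f x) e e0); rewrite -ball_normE. Qed.

Lemma dist_lt_continuous (W : normedModType R) (f : V -> W) x :
  (forall e, 0 < e -> nbhs x [set y | `|f x - f y| < e]) -> {for x, continuous f}.
Proof. by move=> cf; apply/cvgrPdist_lt => e e0; exact: cf. Qed.

Lemma common_ball (W W' : normedModType R) (A : set V) (p : V -> W) (q : V -> W') x e :
  nbhs x A ->
  {for x, continuous p} -> {for x, continuous q} -> 0 < e ->
  exists2 d, 0 < d & forall y, ball x d y ->
    [/\ A y, `|p x - p y| < e & `|q x - q y| < e].
Proof.
move=> nA cp cq e0; have np := continuous_dist_lt cp e0; have nq := continuous_dist_lt cq e0.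
have : nbhs x (A `&` ([set y | `|p x - p y| < e] `&` [set y | `|q x - q y| < e])).
  by apply: filterI => //; exact: filterI.
by move=> /nbhs_ballP[d /= d0 xd]; exists d => // y /xd[? []].
Qed.

Lemma is_derive_line (W : normedModType R) (f : V -> W) x v (t : R) :
  derivable f (x + t *: v) v ->
  is_derive t (1 : R) (fun s : R => f (x + s *: v)) ('D_v f (x + t *: v)).
Proof.
move=> df.
have E : (fun h : R => h^-1 *: (((fun s : R => f (x + s *: v)) \o shift t) (h *: (1 : R)) -
    f (x + t *: v))) = (fun h => h^-1 *: ((f \o shift (x + t *: v)) (h *: v) - f (x + t *: v))).
  apply/funext => h /=; congr (_ *: (f _ - _)).
  by rewrite [h *: 1]mulr1 scalerDl addrCA.
by apply: DeriveDef; rewrite /derivable /derive E.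
Qed.

Lemma is_derive_affine (x v : V) (t : R) : is_derive t (1 : R) (fun s : R => x + s *: v) v.
Proof.
have := @is_derive_line V id x v t; rewrite /=.
move=> /(_ (@derivable_id _ _ _ _)); by rewrite derive_id.
Qed.

Lemma MVT_line (f : V -> R) x v :
  (forall t : R, 0 <= t <= 1 -> derivable f (x + t *: v) v) ->
  exists2 c : R, 0 <= c <= 1 & f (x + v) - f x = 'D_v f (x + c *: v).
Proof.
move=> df.
have := @MVT_segment R (fun s => f (x + s *: v)) (fun s => 'D_v f (x + s *: v)) 0 1 ler01.
case=> [t||c].
- by rewrite in_itv /= => /andP[t0 t1]; apply: is_derive_line; apply: df; rewrite !ltW.
- apply: derivable_within_continuous => t; rewrite in_itv /= => t01.
  by case: (is_derive_line (df t t01)).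
- by rewrite in_itv /= => c01; rewrite scale1r scale0r addr0 subr0 mulr1; exists c.
Qed.

Lemma is_derive_sub (W : normedModType R) (f g : V -> W) x v df dg :
  is_derive x v f df -> is_derive x v g dg ->
  is_derive x v (fun y => f y - g y) (df - dg).
Proof. exact: is_deriveB. Qed.

Lemma derive_translate (W : normedModType R) (f : V -> W) x v k :
  'D_v (fun y => f (y + k)) x = 'D_v f (x + k).
Proof. by rewrite /derive /=; under eq_fun do rewrite -addrA. Qed.

Lemma derivable_translate (W : normedModType R) (f : V -> W) x v k :
  derivable f (x + k) v -> derivable (fun y => f (y + k)) x v.
Proof. by rewrite /derivable /=; under [in X in _ -> X]eq_fun do rewrite -addrA. Qed.

(** Two balls whose radius is half the distance of their centres are disjoint. *)
Lemma no_common_half_ball (a b c : R) :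
  `|a - c| < `|a - b| / 2 -> `|b - c| < `|a - b| / 2 -> False.
Proof.
move=> ac bc; have : `|a - b| < `|a - b|; last by rewrite ltxx.
rewrite {1}(_ : a - b = (a - c) - (b - c)); last by ring.
by rewrite [ltRHS]splitr (le_lt_trans (ler_normB _ _)) // ltrD.
Qed.

(** Two mean value theorems: one for the increment [G] of [f] by [h *: v], along [h *: u], and one
    for ['D_u f] along [h *: v]. The bound on [h] keeps the whole parallelogram in the ball. *)
Lemma second_difference (f : V -> R) (A : set V) x u v (d h : R) :
  C_k 2 A f -> ball x d `<=` A -> 0 <= h -> h * (`|u| + `|v|) < d ->
  exists2 y, ball x d y &
    f (x + h *: u + h *: v) - f (x + h *: u) - (f (x + h *: v) - f x) =
    h * (h * 'D_v ('D_u f) y).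
Proof.
move=> [df /(_ u)[duf _]] xdA h0 hd.
have xA s t : 0 <= s <= 1 -> 0 <= t <= 1 -> ball x d (x + s *: (h *: u) + t *: (h *: v)).
  move=> /andP[s0 s1] /andP[t0 t1]; rewrite -ball_normE /= -addrA opprD addNKr normrN.
  apply: le_lt_trans hd; rewrite (le_trans (ler_normD _ _)) // mulrDr !normrZ.
  by rewrite lerD // ger0_norm // ?(ger0_norm h0) ler_piMl // mulr_ge0.
have i0 : 0 <= (0 : R) <= 1 by rewrite lexx ler01.
have i1 : 0 <= (1 : R) <= 1 by rewrite lexx ler01.
have xA0 s : 0 <= s <= 1 -> ball x d (x + s *: (h *: u)).
  by move=> si; have := xA s 0 si i0; rewrite scale0r addr0.
have xA1 s : 0 <= s <= 1 -> ball x d (x + s *: (h *: u) + h *: v).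
  by move=> si; have := xA s 1 si i1; rewrite scale1r.
pose G y := f (y + h *: v) - f y.
have dG s w : 0 <= s <= 1 -> is_derive (x + s *: (h *: u)) w G
   ('D_w f (x + s *: (h *: u) + h *: v) - 'D_w f (x + s *: (h *: u))).
  move=> si; apply: is_deriveB.
    apply: DeriveDef; last exact: derive_translate.
    by apply: derivable_translate; apply/diff_derivable/df/xdA/xA1.
  by apply: DeriveDef => //; apply/diff_derivable/df/xdA/xA0.
have [s|s si] := @MVT_line G x (h *: u); first by move=> /dG dGs; case: (dGs (h *: u)).
rewrite /G (derive_val (is_derive := dG s _ si)) addrAC.
have dZ w y : ball x d y -> 'D_(h *: w) f y = h * 'D_w f y.
  by move=> /xdA/df dfy; rewrite !deriveE // linearZ.
have dZ' w y : ball x d y -> 'D_(h *: w) ('D_u f) y = h * 'D_w ('D_u f) y.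
  by move=> /xdA/duf dfy; rewrite !deriveE // linearZ.
rewrite !dZ; [|exact: xA0|exact: xA1].
have [t ti|t ti E ->] := @MVT_line ('D_u f) (x + s *: (h *: u)) (h *: v).
  by apply/diff_derivable/duf/xdA/xA.
exists (x + s *: (h *: u) + t *: (h *: v)); first exact: xA.
by rewrite -mulrBr E dZ' //; exact: xA.
Qed.

(** The second difference is symmetric in [u] and [v], so the two mixed derivatives take a common
    value at points [y] and [z] arbitrarily close to [x]; by continuity they cannot differ at
    [x]. *)
Lemma deriveC (f : V -> R) (A : set V) x u v : open A -> C_k 2 A f -> A x ->
  'D_u ('D_v f) x = 'D_v ('D_u f) x.
Proof.
move=> oA cf Ax; pose p : V -> R := 'D_u ('D_v f); pose q : V -> R := 'D_v ('D_u f).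
rewrite -[LHS]/(p x) -[RHS]/(q x); apply/eqP/negP => /negP ab.
have e0 : 0 < `|p x - q x| / 2 by rewrite divr_gt0 // normr_gt0 subr_eq0.
have cp : {for x, continuous p} by have [_ /(_ v)[_ /(_ u) /(_ x Ax)]] := cf.
have cq : {for x, continuous q} by have [_ /(_ u)[_ /(_ v) /(_ x Ax)]] := cf.
have [d d0 xd] := common_ball (open_nbhs_nbhs (conj oA Ax)) cp cq e0.
have xdA : ball x d `<=` A by move=> y /xd[].
(* The [1] covers the case in which both directions vanish. *)
pose h := d / (`|u| + `|v| + 1).
have p0 : 0 < `|u| + `|v| + 1 by rewrite ltr_wpDl // addr_ge0.
have h0 : 0 < h by rewrite divr_gt0.
have hd : h * (`|u| + `|v|) < d.
  by rewrite /h mulrAC -mulrA gtr_pMr // ltr_pdivrMr // mul1r ltrDl.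
have hd' : h * (`|v| + `|u|) < d by rewrite [_ + `|u|]addrC.
have [y /xd[_ _ yb]] := second_difference cf xdA (ltW h0) hd.
have [z /xd[_ za _]] := second_difference cf xdA (ltW h0) hd'.
move=> Ez Ey; have E : q y = p z.
  have hn0 : h != 0 by rewrite gt_eqF.
  apply: (mulfI hn0); apply: (mulfI hn0); apply: etrans (esym Ey) _; apply: etrans Ez.
  by rewrite [x + h *: v + _]addrAC; ring.
by rewrite E in yb; exact: (no_common_half_ball za yb).
Qed.

End Lines.

(** * Differentiability through estimates in the matrix norm *)

(* The join with [normedModType] that [banach_fixed_point] needs. *)
HB.instance Definition _ (R : realType) (m n : nat) := Complete.on 'M[R]_(m, n).

Section MatrixNorm.
Variable R : realType.

Lemma ler_mx_entry m n (M : 'M[R]_(m, n)) i j : `|M i j| <= `|M|.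
Proof. by rewrite [leRHS]/Num.Def.normr /= mx_normrE (le_bigmax _ _ (i, j)). Qed.

Lemma mx_norm_le m n (M : 'M[R]_(m, n)) e :
  0 <= e -> (forall i j, `|M i j| <= e) -> `|M| <= e.
Proof.
by move=> e0 Me; rewrite /Num.Def.normr /= mx_normrE bigmax_le // => -[i j] _; exact: Me.
Qed.

(** The norm is the largest absolute value of an entry, and an entry of the product is a sum of [n]
    terms; hence the factor [n]. *)
Lemma ler_norm_mulmx m n p (M : 'M[R]_(m, n)) (N : 'M[R]_(n, p)) :
  `|M *m N| <= n%:R * `|M| * `|N|.
Proof.
apply: mx_norm_le => [|i j]; first by rewrite !mulr_ge0.
rewrite mxE (le_trans (ler_norm_sum _ _ _)) //.
rewrite (@le_trans _ _ (\sum_(l < n) `|M| * `|N|)) //.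
  by apply: ler_sum => l _; rewrite normrM ler_pM // ler_mx_entry.
by rewrite sumr_const card_ord -mulrA mulr_natl.
Qed.

Lemma continuous_mulmxr n m (M : 'M[R]_(n, m)) :
  continuous (fun h : 'rV[R]_n => h *m M).
Proof.
move=> x; apply: dist_lt_continuous => e e0.
have k0 : 0 < n%:R * `|M| + 1 by rewrite ltr_wpDl // mulr_ge0.
have : nbhs x (ball x (e / (n%:R * `|M| + 1))) by apply: nbhsx_ballx; rewrite divr_gt0.
apply: filterS => y; rewrite -ball_normE /= => xy.
rewrite -mulmxBl (le_lt_trans (ler_norm_mulmx _ _)) // mulrAC.
rewrite (@le_lt_trans _ _ ((n%:R * `|M| + 1) * `|x - y|)) //.
  by rewrite ler_wpM2r // lerDl.
by rewrite mulrC -ltr_pdivlMr.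
Qed.

Lemma differentiable_mulmxP n m (F : 'rV[R]_n -> 'rV[R]_m) x M :
  (forall e, 0 < e -> nbhs (0 : 'rV[R]_n) [set h | `|F (h + x) - F x - h *m M| <= e * `|h|]) ->
  differentiable F x /\ forall v, 'D_v F x = v *m M.
Proof.
move=> FM; have cL : continuous (mulmxr M : 'rV[R]_n -> 'rV[R]_m) by exact: continuous_mulmxr.
have E : F \o shift x = cst (F x) + (mulmxr M : 'rV[R]_n -> 'rV[R]_m) +o_ 0 id.
  apply/eqaddoP => e e0; apply: filterS (FM e e0) => h /=.
  by rewrite !fctE /= opprD addrA.
have D := diff_unique cL E.
have dF : differentiable F x by apply/diff_locallyP; rewrite D.
by split=> // v; rewrite deriveE // D.
Qed.

Lemma differentiable_near (V W : normedModType R) (F : V -> W) x e :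
  differentiable F x -> 0 < e ->
  nbhs (0 : V) [set h | `|F (h + x) - F x - 'D_h F x| <= e * `|h|].
Proof.
move=> dF e0; have [_ /eqaddoP /(_ e e0)] := (diff_locallyP _ _).1 dF.
by apply: filterS => h /=; rewrite !fctE /= opprD addrA deriveE.
Qed.

(** Directional derivatives alone do not give differentiability; the continuity of [B] does. For
    each entry the mean value theorem turns the remainder into an entry of
    [h *m (B (x + t *: h) - B x)], with [t] depending on the entry. *)
Lemma differentiable_of_derive n m (A : set 'rV[R]_n) (F : 'rV[R]_n -> 'rV[R]_m)
    (B : 'rV[R]_n -> 'M[R]_(n, m)) x :
  open A -> A x -> C_k 0 A B ->
  (forall y v, A y -> is_derive y v F (v *m B y)) ->
  differentiable F x.
Proof.
move=> oA Ax cB dF; apply: (proj1 (differentiable_mulmxP (M := B x) _)) => e e0.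
have k0 : 0 < n%:R + 1 :> R by rewrite ltr_wpDl.
have ek0 : 0 < e / (n%:R + 1) by rewrite divr_gt0.
have [d d0 xd] := common_ball (open_nbhs_nbhs (conj oA Ax)) (cB x Ax) (cB x Ax) ek0.
have : nbhs (0 : 'rV[R]_n) (ball 0 d) by exact: nbhsx_ballx.
apply: filterS => h; rewrite -ball_normE /= sub0r normrN => hd.
apply: mx_norm_le => [|i j]; first by rewrite mulr_ge0 // ltW.
have xh (t : R) : 0 <= t <= 1 -> ball x d (x + t *: h).
  move=> /andP[t0 t1]; rewrite -ball_normE /= opprD addNKr normrN normrZ ger0_norm //.
  by apply: le_lt_trans hd; rewrite ler_piMl.
have [t t01|t t01] := @MVT_line _ _ (fun y => F y i j) x h.
  have /xh/xd[At _ _] := t01.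
  by have /derivable_mxP := ex_derive (is_derive := dF (x + t *: h) h At); exact.
have /xh/xd[At Bt _] := t01.
rewrite -derive_entry; last by case: (dF (x + t *: h) h At).
rewrite (derive_val (is_derive := dF _ _ At)) => E.
have -> : (F (h + x) - F x - h *m B x) i j = (h *m (B (x + t *: h) - B x)) i j.
  by rewrite mulmxBr [RHS]mxE -E [h + x]addrC !mxE.
rewrite (le_trans (ler_mx_entry _ _ _)) // (le_trans (ler_norm_mulmx _ _)) //.
rewrite mulrAC ler_wpM2r // (le_trans (y := (n%:R + 1) * `|B (x + t *: h) - B x|)) //.
  by rewrite ler_wpM2r // lerDl.
by rewrite mulrC -ler_pdivlMr // distrC ltW.
Qed.

Lemma smooth_of_derive n m (A : set 'rV[R]_n) (F : 'rV[R]_n -> 'rV[R]_m)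
    (B : 'rV[R]_n -> 'M[R]_(n, m)) :
  open A -> smooth_on A B ->
  (forall y v, A y -> is_derive y v F (v *m B y)) -> smooth_on A F.
Proof.
move=> oA sB dF k.
have dF' x : A x -> differentiable F x.
  by move=> Ax; apply: differentiable_of_derive oA Ax (sB 0%N) dF.
case: k => [|k]; first by move=> x /dF'; exact: differentiable_continuous.
split=> // v; apply: (C_k_ext oA) (C_k_mulmx oA (C_k_cst k A v) (sB k)) => x Ax.
by rewrite (derive_val (is_derive := dF x v Ax)).
Qed.

End MatrixNorm.

(** * The inverse function theorem *)

Section InverseFunction.
Variables (R : realType) (n' : nat).
Let n := n'.+1.
Variables (F : 'rV[R]_n -> 'rV[R]_n) (B : 'rV[R]_n -> 'M[R]_n) (A : set 'rV[R]_n) (x0 : 'rV[R]_n).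
Hypotheses (oA : open A) (Ax0 : A x0) (cB : C_k 0 A B)
  (dF : forall x v, A x -> is_derive x v F (v *m B x))
  (uB : forall x, A x -> B x \in unitmx).

Let J := invmx (B x0).
(** Newton's map with frozen derivative: the fixed points of [Phi x + y *m J] are the solutions of
    [F x = y]. *)
Let Phi x := x - F x *m J.

Let differentiable_F x : A x -> differentiable F x.
Proof. by move=> Ax; exact: differentiable_of_derive oA Ax cB (fun y v => dF v). Qed.

(** The derivative [D] of [Phi] vanishes at [x0], hence is small nearby. The bound [(2 * n%:R)^-1]
    makes up for the factor [n] of [ler_norm_mulmx], and halving the radius fits a closed ball into
    the open one. *)
Lemma half_contraction : exists2 r : R, 0 < r &
  (forall x, `|x0 - x| <= r -> A x) /\
  (forall x y, `|x0 - x| <= r -> `|x0 - y| <= r -> `|Phi x - Phi y| <= 2^-1 * `|x - y|).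
Proof.
pose D x := 1%:M - B x *m J.
have n0 : 0 < n%:R :> R by rewrite ltr0n.
have cD : C_k 0 A D.
  apply: (C_kD oA (C_k_cst 0 A 1%:M)).
  apply: (C_k_ext oA) (C_k_mulmx oA cB (C_k_cst 0 A (- J))) => x Ax.
  by rewrite mulmxN.
have D0 : D x0 = 0 by rewrite /D /J mulmxV ?subrr // uB.
have e0 : 0 < (2 * n%:R)^-1 :> R by rewrite invr_gt0 mulr_gt0.
have [d d0 xd] := common_ball (open_nbhs_nbhs (conj oA Ax0)) (cD x0 Ax0) (cD x0 Ax0) e0.
have rd x : `|x0 - x| <= d / 2 -> ball x0 d x.
  by rewrite -ball_normE /= => /le_lt_trans; apply; rewrite ltr_pdivrMr // ltr_pMr // ltr1n.
exists (d / 2); first by rewrite divr_gt0.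
split=> [x /rd/xd[]//|x y xr yr].
have dPhi z v : A z -> is_derive z v Phi (v *m D z).
  move=> Az; have dFz := dF v Az.
  have dFJ : is_derive z v (fun z => F z *m J) (v *m B z *m J).
    apply: DeriveDef; first by apply: derivable_mulmx; [case: dFz|exact: derivable_cst].
    rewrite derive_mulmx; [|by case: dFz|exact: derivable_cst].
    by rewrite derive_cst mulmx0 addr0 (derive_val (is_derive := dFz)).
  have -> : v *m D z = v - v *m B z *m J by rewrite /D mulmxBr mulmx1 mulmxA.
  exact: (is_derive_sub (is_derive_id z v) dFJ).
have seg (t : R) : 0 <= t <= 1 -> `|x0 - (y + t *: (x - y))| <= d / 2.
  move=> /andP[t0 t1].
  rewrite (_ : x0 - _ = (1 - t) *: (x0 - y) + t *: (x0 - x)); last first.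
    by apply/rowP => i; rewrite !mxE; ring.
  rewrite (le_trans (ler_normD _ _)) // !normrZ !ger0_norm ?subr_ge0 //.
  rewrite (@le_trans _ _ ((1 - t) * (d / 2) + t * (d / 2))) //.
    by rewrite lerD // ler_wpM2l // subr_ge0.
  by rewrite -mulrDl subrK mul1r.
have dn : forall z v, A z -> derivable Phi z v by move=> z v Az; case: (dPhi z v Az).
apply: mx_norm_le => [|i j]; first by rewrite mulr_ge0.
have [t t01|t t01] := @MVT_line _ _ (fun z => Phi z i j) y (x - y).
  have /seg/rd/xd[At _ _] := t01.
  by have /derivable_mxP := dn _ (x - y) At; exact.
have /seg/rd/xd[At Dt _] := t01.
rewrite -derive_entry; last exact: dn.
rewrite (derive_val (is_derive := dPhi _ _ At)) addrCA subrr addr0 => E.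
rewrite (_ : (Phi x - Phi y) i j = Phi x i j - Phi y i j); last by rewrite !mxE.
rewrite E (le_trans (ler_mx_entry _ _ _)) // (le_trans (ler_norm_mulmx _ _)) //.
rewrite mulrAC ler_wpM2r // -ler_pdivlMl //.
by move: Dt; rewrite D0 sub0r normrN -invfM mulrC => /ltW.
Qed.

Theorem inverse_function : exists (W : set 'rV[R]_n) (G : 'rV[R]_n -> 'rV[R]_n) (d : R),
  [/\ open W /\ W x0, W `<=` A, 0 < d,
     (forall x, W x -> ball (F x0) d (F x) /\ G (F x) = x) &
     (forall y, ball (F x0) d y -> [/\ W (G y), F (G y) = y, differentiable G y &
        forall v, 'D_v G y = v *m invmx (B (G y))])].
Proof.
have [r r0 [rA Phi_lip]] := half_contraction.
have uJ : J \in unitmx by rewrite unitmx_inv uB.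
pose K := n%:R * `|J| + 1.
have K0 : 0 < K by rewrite ltr_wpDl // mulr_ge0.
have normJ (v : 'rV[R]_n) : `|v *m J| <= K * `|v|.
  by rewrite (le_trans (ler_norm_mulmx _ _)) // mulrAC ler_wpM2r // lerDl.
(* For [y] within [d] of [F x0], the term [(F x0 - y) *m J] has norm less than r/2. The contraction
   accounts for the other half, so the closed ball is mapped into the open one. *)
pose d := r / 2 / K.
have d0 : 0 < d by rewrite !divr_gt0.
pose U := [set x | `|x0 - x| <= r].
have x0U : U x0 by rewrite /U /= subrr normr0 ltW.
have Tin y x : ball (F x0) d y -> U x -> `|x0 - (Phi x + y *m J)| < r.
  move=> yd Ux.
  rewrite (_ : x0 - _ = (Phi x0 - Phi x) + (F x0 - y) *m J); last first.
    by rewrite mulmxBl /Phi; apply/rowP => i; rewrite !mxE; ring.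
  rewrite (le_lt_trans (ler_normD _ _)) // [ltRHS]splitr ler_ltD //.
    by rewrite (le_trans (Phi_lip _ _ x0U Ux)) // mulrC ler_wpM2r.
  by rewrite (le_lt_trans (normJ _)) // mulrC -ltr_pdivlMr // -/d; move: yd; rewrite -ball_normE.
have closedU : closed U.
  rewrite (_ : U = closed_ball x0 r); first exact: closed_ball_closed.
  by rewrite closed_ballE.
have solve y : ball (F x0) d y -> exists x, `|x0 - x| < r /\ F x = y.
  move=> yd; pose T x := Phi x + y *m J.
  have TU : {homo T : x / U x >-> U x} by move=> x Ux; exact/ltW/Tin.
  have ctr : is_contraction [fun of mkfun TU].
    exists 2^-1%:nng; split; first by rewrite /= invf_lt1 // ltr1n.
    move=> [x z] [/= Ux Uz]; rewrite /mkfun /T opprD addrACA subrr addr0.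
    exact: Phi_lip.
  have [p Up pT] := banach_fixed_point ctr closedU (ex_intro _ _ x0U).
  exists p; split; first by rewrite {1}pT; exact: Tin.
  have : (F p - y) *m J = 0.
    rewrite mulmxBl; move: pT; rewrite /= /mkfun /T /Phi => pT.
    by apply/eqP; rewrite subr_eq0 -(inj_eq (addrI (p - F p *m J))) subrK {1}pT.
  move=> /(congr1 (mulmx^~ (B x0))); rewrite mul0mx -mulmxA mulVmx ?uB // mulmx1.
  by move/eqP; rewrite subr_eq0 => /eqP.
(* Half of [x - z] is absorbed by the contraction. This gives injectivity of [F] on [U] and the
   Lipschitz constant [2 * K] of its inverse. *)
have bilip x z : U x -> U z -> `|x - z| <= 2 * K * `|F x - F z|.
  move=> Ux Uz; have := Phi_lip _ _ Ux Uz.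
  have -> : x - z = (Phi x - Phi z) + (F x - F z) *m J.
    by rewrite mulmxBl /Phi; apply/rowP => i; rewrite !mxE; ring.
  set a := Phi x - Phi z; have := normJ (F x - F z); set b := _ *m J => bK ab.
  have := ler_normD a b; lra.
have injF x z : U x -> U z -> F x = F z -> x = z.
  move=> Ux Uz E; apply/eqP; rewrite -subr_eq0 -normr_le0.
  by rewrite (le_trans (bilip _ _ Ux Uz)) // E subrr normr0 mulr0.
(* The default [x0] is returned when there is no solution, which [solve] excludes for [y] in the
   ball. *)
pose G y := xget x0 [set x | `|x0 - x| < r /\ F x = y].
have GP y : ball (F x0) d y -> `|x0 - G y| < r /\ F (G y) = y.
  move=> /solve[x xy]; rewrite /G; case: xgetP => [z _ //|/(_ x)] nx.
  by case: nx.
have cF x : A x -> {for x, continuous F}.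
  by move=> Ax; exact/differentiable_continuous/differentiable_F.
(* Cutting with the preimage of the target ball makes [F] a bijection from [W] onto that ball. *)
exists [set x | `|x0 - x| < r /\ ball (F x0) d (F x)], G, d; split=> //.
- split; last by rewrite /= subrr normr0; split=> //; exact: ballxx.
  rewrite openE => x [/= xr Fxd].
  have xA : A x by apply/rA/ltW.
  have n1 : nbhs x (ball x0 r).
    by apply: open_nbhs_nbhs; split; [exact: ball_open|rewrite -ball_normE].
  have n2 : nbhs x (F @^-1` ball (F x0) d).
    by apply: (cF x xA); apply: open_nbhs_nbhs; split=> //; exact: ball_open.
  have : nbhs x (ball x0 r `&` F @^-1` ball (F x0) d) by exact: filterI.
  by apply: filterS => z []; rewrite -ball_normE.
- by move=> x [/= xr _]; exact/rA/ltW.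
- move=> x [/= xr Fxd]; split=> //.
  by have [Gr /injF] := GP _ Fxd; apply; exact/ltW.
move=> y yd; have [Gr FG] := GP _ yd.
have AG : A (G y) by apply/rA/ltW.
set M := B (G y); have uM : M \in unitmx by exact: uB.
suff [dG DG] : differentiable G y /\ forall v, 'D_v G y = v *m invmx M.
  by split=> //=; rewrite FG.
apply: differentiable_mulmxP => e e0.
pose L := n%:R * `|invmx M| + 1.
have L0 : 0 < L by rewrite ltr_wpDl // mulr_ge0.
(* The final estimate loses a factor [L] through [invmx M] and a factor [2 * K] through the
   Lipschitz bound on [G]. *)
have e'0 : 0 < e / (L * (2 * K)) by rewrite divr_gt0 // mulr_gt0 // mulr_gt0.
have := differentiable_near (differentiable_F AG) e'0.
move=> /nbhs_ballP[s /= s0 sP].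
have n1 : nbhs (0 : 'rV[R]_n) (ball 0 (s / (2 * K))).
  by apply: nbhsx_ballx; rewrite divr_gt0 // mulr_gt0.
have n2 : nbhs (0 : 'rV[R]_n) [set h | ball (F x0) d (h + y)].
  have : nbhs y (ball (F x0) d) by apply: open_nbhs_nbhs; split=> //; exact: ball_open.
  by move=> /nbhs0P; apply: filterS => h /=; rewrite addrC.
apply: filterS2 n1 n2 => k; rewrite -[ball 0 _ k]/(_) -ball_normE /= sub0r normrN => ks kd.
have [Gkr FGk] : `|x0 - G (k + y)| < r /\ F (G (k + y)) = k + y.
  by apply: GP; rewrite -ball_normE.
set h := G (k + y) - G y.
have hk : `|h| <= 2 * K * `|k|.
  rewrite (le_trans (bilip _ _ (ltW Gkr) (ltW Gr))) // FGk FG.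
  by rewrite addrK.
have : ball (0 : 'rV[R]_n) s h.
  rewrite -ball_normE /= sub0r normrN (le_lt_trans hk) //.
  by rewrite mulrC -ltr_pdivlMr // mulr_gt0.
move=> /sP /=; rewrite subrK FGk FG addrK (derive_val (is_derive := dF _ AG)) -/M.
have -> : h - k *m invmx M = - ((k - h *m M) *m invmx M).
  by rewrite mulmxBl -[h *m M *m _]mulmxA mulmxV // mulmx1 opprB.
rewrite normrN => kh; rewrite (le_trans (ler_norm_mulmx _ _)) //.
rewrite mulrAC (@le_trans _ _ (L * `|k - h *m M|)) //.
  by rewrite ler_wpM2r // lerDl.
rewrite (@le_trans _ _ (L * (e / (L * (2 * K)) * (2 * K * `|k|)))) //.
  by rewrite ler_pM2l // (le_trans kh) // ler_wpM2l // ltW.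
have -> // : L * (e / (L * (2 * K)) * (2 * K * `|k|)) = e * `|k|.
by field; rewrite !gt_eqF.
Qed.

End InverseFunction.

(** * Primitives of closed forms *)

Section Poincare.
Variables (R : realType) (n : nat).
Variables (b : 'rV[R]_n -> 'cV[R]_n) (x0 : 'rV[R]_n) (d K : R).
Hypotheses (d0 : 0 < d) (cb : C_k 1 (ball x0 d) b).
(** These two bounds provide the dominating constant for differentiation under the integral sign. *)
Hypothesis b_le : forall y, ball x0 d y -> `|b y| <= K.
Hypothesis Db_le : forall y v, ball x0 d y -> `|'D_v b y| <= K * `|v|.
Hypothesis closed_b : forall y u v, ball x0 d y -> u *m 'D_v b y = v *m 'D_u b y.

Let mu := @lebesgue_measure R.
Let form (u v : 'rV[R]_n) (t : R) : R := (v *m b (x0 + t *: u)) 0 0.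
(** The radial homotopy operator of the Poincare lemma: the integral of the one-form [b] along the
    segment from [x0] to [x]. *)
Definition primitive (x : 'rV[R]_n) : R :=
  \int[mu]_(t in `[0, 1]) form (x - x0) (x - x0) t.

Let in_ball u (t : R) : `|u| < d -> 0 <= t <= 1 -> ball x0 d (x0 + t *: u).
Proof.
move=> ud /andP[t0 t1]; rewrite -ball_normE /= opprD addNKr normrN normrZ ger0_norm //.
by apply: le_lt_trans ud; rewrite ler_piMl.
Qed.

Let db y v : ball x0 d y -> derivable b y v.
Proof. by move=> yd; apply: diff_derivable; case: cb => + _; exact. Qed.

Let DbZ y v (t : R) : ball x0 d y -> 'D_(t *: v) b y = t *: 'D_v b y.
Proof. by move=> yd; case: cb => /(_ y yd) dby _; rewrite !deriveE // linearZ. Qed.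

Let is_derive_b_line u (t : R) : `|u| < d -> 0 <= t <= 1 ->
  is_derive t (1 : R) (fun s : R => b (x0 + s *: u)) ('D_u b (x0 + t *: u)).
Proof. by move=> ud t01; apply: is_derive_line; apply: db; exact: in_ball. Qed.

Lemma derivable_form u v (t : R) : `|u| < d -> 0 <= t <= 1 ->
  is_derive t (1 : R) (form u v) ((v *m 'D_u b (x0 + t *: u)) 0 0).
Proof.
move=> ud t01; have dl := is_derive_b_line ud t01.
have dM : derivable (fun s : R => v *m b (x0 + s *: u)) t 1.
  by apply: derivable_mulmx; [exact: derivable_cst|case: dl].
apply: DeriveDef; first by have /derivable_mxP := dM; exact.
rewrite /form -derive_entry // derive_mulmx; [|exact: derivable_cst|by case: dl].
by rewrite derive_cst mul0mx add0r (derive_val (is_derive := dl)).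
Qed.

(** It plays two roles: it is the derivative of the integrand of [primitive] in the direction [v],
    and, for a closed form, the derivative in [t] of [t * form u v t]. Hence its integral over the
    unit interval is explicit. *)
Let dform u v (t : R) := (v *m b (x0 + t *: u)) 0 0 + t * (u *m 'D_v b (x0 + t *: u)) 0 0.

Lemma is_derive_form_param x v (s t : R) : `|x + s *: v - x0| < d -> 0 <= t <= 1 ->
  is_derive s (1 : R) (fun s : R => form (x + s *: v - x0) (x + s *: v - x0) t)
    (dform (x + s *: v - x0) v t).
Proof.
move=> xd t01.
have E (r : R) : x0 + t *: (x + r *: v - x0) = (x0 + t *: (x - x0)) + r *: (t *: v).
  by apply/rowP => i; rewrite !mxE; ring.
have bd := in_ball xd t01.
have d1 : is_derive s (1 : R) (fun r : R => b (x0 + t *: (x + r *: v - x0)))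
    (t *: 'D_v b (x0 + t *: (x + s *: v - x0))).
  rewrite (_ : (fun r => _) = fun r : R => b ((x0 + t *: (x - x0)) + r *: (t *: v))); last first.
    by apply/funext => r; rewrite E.
  have dby : derivable b (x0 + t *: (x - x0) + s *: (t *: v)) (t *: v) by rewrite -E; exact: db.
  by have := is_derive_line dby; rewrite -E (DbZ v t bd).
have d2 : is_derive s (1 : R) (fun r : R => x + r *: v - x0) v.
  rewrite (_ : (fun r : R => _) = fun r : R => (x - x0) + r *: v); last first.
    by apply/funext => r; rewrite addrAC.
  exact: is_derive_affine.
have dM : derivable (fun r : R => (x + r *: v - x0) *m b (x0 + t *: (x + r *: v - x0))) s 1.
  by apply: derivable_mulmx; [case: d2|case: d1].
apply: DeriveDef; first by have /derivable_mxP := dM; exact.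
rewrite /form -derive_entry // derive_mulmx; [|by case: d2|by case: d1].
rewrite (derive_val (is_derive := d2)) (derive_val (is_derive := d1)) /dform.
by rewrite -scalemxAr !mxE.
Qed.

(** Here closedness enters: the product rule produces [v *m 'D_u b], while [dform] contains
    [u *m 'D_v b]. *)
Lemma is_derive_scaled_form u v (t : R) : `|u| < d -> 0 <= t <= 1 ->
  is_derive t (1 : R) (fun t => t * form u v t) (dform u v t).
Proof.
move=> ud t01; have dF := derivable_form v ud t01.
apply: is_derive_eq (is_deriveM (is_derive_id t (1 : R)) dF) _.
rewrite /dform (closed_b u v (in_ball ud t01)) addrC; congr (_ + _).
by rewrite [_ *: _]mulr1.
Qed.

Let form_continuous u v : `|u| < d -> {within `[0, 1], continuous (form u v)}.
Proof.
move=> ud; apply: derivable_within_continuous => t; rewrite in_itv /= => t01.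
by case: (derivable_form v ud t01).
Qed.

Let dform_continuous u v : `|u| < d -> {within `[0, 1], continuous (dform u v)}.
Proof.
move=> ud; have [_ /(_ v) cDb] := cb.
apply: continuous_in_subspaceT => t; rewrite inE /= in_itv /= => t01.
have cl : {for t, continuous (fun s : R => x0 + s *: u)}.
  apply/differentiable_continuous/derivable1_diffP.
  by case: (is_derive_affine x0 u t).
have cl' : continuous (fun s : R => x0 + s *: u).
  by move=> r; apply/differentiable_continuous/derivable1_diffP; case: (is_derive_affine x0 u r).
pose T := (fun s : R => x0 + s *: u) @^-1` ball x0 d.
have oT : open T by apply: open_comp => [r _|]; [exact: cl'|exact: ball_open].
have Tt : T t by exact: in_ball.
have cD : C_k 0 T (fun s : R => 'D_v b (x0 + s *: u)).
  move=> r Tr; apply: (@continuous_comp _ _ _ (fun s : R => x0 + s *: u) ('D_v b)); first exact: cl'.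
  exact: cDb.
have cf : {for t, continuous (form u v)}.
  by apply/differentiable_continuous/derivable1_diffP; case: (derivable_form v ud t01).
have cg : {for t, continuous (fun s : R => (u *m 'D_v b (x0 + s *: u)) 0 0)}.
  by have /(C_k_mxP _ _ oT) := C_k_mulmx oT (C_k_cst 0 T u) cD; move=> /(_ 0 0) /(_ t Tt).
by apply: cvgD; [exact: cf|apply: cvgM; [exact: cvg_id|exact: cg]].
Qed.

Lemma is_derive_primitive x v : ball x0 d x -> is_derive x v primitive ((v *m b x) 0 0).
Proof.
move=> xd; have xd' : `|x - x0| < d by move: xd; rewrite -ball_normE /= distrC.
pose e := (d - `|x - x0|) / (`|v| + 1).
have v0 : 0 < `|v| + 1 by rewrite ltr_wpDl.
have e0 : 0 < e by rewrite divr_gt0 // subr_gt0.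
have small (s : R) : `]-e, e[%classic s -> `|x + s *: v - x0| < d.
  rewrite /= in_itv /= -ltr_norml => se; rewrite addrAC (le_lt_trans (ler_normD _ _)) //.
  rewrite -ltrBrDl normrZ (@le_lt_trans _ _ (`|s| * (`|v| + 1))) //.
    by rewrite ler_wpM2l // lerDl.
  by rewrite -ltr_pdivlMr.
pose f (s t : R) : R := form (x + s *: v - x0) (x + s *: v - x0) t.
have K0 : 0 <= K by rewrite (le_trans _ (b_le (ballxx x0 d0))).
(* The two summands bound those of [dform], where [t] is at most 1 and the radius vector is shorter
   than [d]. *)
pose C := n%:R * `|v| * K + n%:R * d * (K * `|v|).
have C0 : 0 <= C by rewrite addr_ge0 // !mulr_ge0 // ltW.
have mB : measurable (`[0, 1]%classic : set (measurableTypeR R)) by exact: measurable_itv.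
have I0 : `]-e, e[%classic (0 : R) by rewrite /= in_itv /= oppr_lt0 e0.
have intf s : `]-e, e[%classic s -> mu.-integrable `[0, 1] (EFin \o f s).
  move=> /small sd; apply: continuous_compact_integrable; first exact: segment_compact.
  exact: form_continuous.
have derf (s t : R) : `]-e, e[%classic s -> `[0, 1]%classic t ->
    is_derive s (1 : R) (f ^~ t) (dform (x + s *: v - x0) v t).
  by move=> /small sd; rewrite /= in_itv /= => t01; exact: is_derive_form_param.
have derf1 (s t : R) : `]-e, e[%classic s -> `[0, 1]%classic t -> derivable (f ^~ t) s 1.
  by move=> Is It; case: (derf s t Is It).
have d1E s t : `]-e, e[%classic s -> `[0, 1]%classic t ->
    partial1of2 f s t = dform (x + s *: v - x0) v t.
  by move=> Is It; rewrite partial1of2E (derive_val (is_derive := derf s t Is It)).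
have G_ub (s t : R) : `]-e, e[%classic s -> `[0, 1]%classic t -> `|partial1of2 f s t| <= C.
  move=> Is It; rewrite d1E //; have sd := small s Is.
  move: It; rewrite /= in_itv /= => t01; have /andP[t0 t1] := t01.
  have bd := in_ball sd t01.
  rewrite (le_trans (ler_normD _ _)) // lerD //.
    rewrite (le_trans (ler_mx_entry _ _ _)) // (le_trans (ler_norm_mulmx _ _)) //.
    by rewrite ler_wpM2l ?mulr_ge0 // b_le.
  rewrite normrM ger0_norm // (@le_trans _ _ (1 * (n%:R * d * (K * `|v|)))) ?mul1r //.
  rewrite -[leRHS]mul1r ler_pM // (le_trans (ler_mx_entry _ _ _)) //.
  rewrite (le_trans (ler_norm_mulmx _ _)) // ler_pM ?mulr_ge0 //.
    by rewrite ler_wpM2l // ltW.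
  exact: Db_le.
have intG : mu.-integrable `[0, 1] (EFin \o (fun=> C)).
  apply: continuous_compact_integrable; first exact: segment_compact.
  by apply: continuous_subspaceT; exact: cst_continuous.
have := @cvg_differentiation_under_integral R _ _ mu f _ mB 0 (- e) e I0 intf derf1
  (fun=> C) (fun=> C0) intG G_ub.
have -> : \int[mu]_(t in `[0, 1]) partial1of2 f 0 t = (v *m b x) 0 0.
  rewrite (@eq_Rintegral _ _ _ mu _ (dform (x - x0) v)); last first.
    by move=> t; rewrite inE => It; rewrite (d1E _ _ I0 It) scale0r addr0.
  (* The fundamental theorem for [t * form (x - x0) v t]: it vanishes at 0, and at 1 it is the value
     of the form at [x] on [v]. *)
  rewrite /Rintegral (@continuous_FTC2 _ _ (fun t => t * form (x - x0) v t)) ?ltr01 //.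
  - rewrite -EFinB /= mul1r mul0r subr0 /form scale1r addrCA subrr addr0 //.
  - exact: dform_continuous.
  - have ct (t : R) : 0 <= t <= 1 -> {for t, continuous (fun s : R => s * form (x - x0) v s : R)}.
      move=> t01; apply/differentiable_continuous/derivable1_diffP.
      by case: (is_derive_scaled_form v xd' t01).
    split.
    + move=> t; rewrite in_itv /= => /andP[t0 t1].
      by case: (@is_derive_scaled_form (x - x0) v t xd'); rewrite ?(ltW t0) ?(ltW t1).
    + by apply: cvg_at_right_filter; apply: ct; rewrite lexx ler01.
    + by apply: cvg_at_left_filter; apply: ct; rewrite lexx ler01.
  - move=> t; rewrite in_itv /= => /andP[t0 t1]; rewrite derive1E.
    apply: derive_val; apply: is_derive_scaled_form => //.
    by rewrite (ltW t0) (ltW t1).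
have E : (fun h : R => h^-1 *: (\int[mu]_(t in `[0, 1]) f (h + 0) t - \int[mu]_(t in `[0, 1]) f 0 t)) =
    (fun h : R => h^-1 *: ((primitive \o shift x) (h *: v) - primitive x)).
  by apply/funext => h; rewrite /f /primitive /= addr0 scale0r addr0 [h *: v + x]addrC.
rewrite E => cvgP; apply: DeriveDef; first by apply/cvg_ex; eexists; exact: cvgP.
exact/cvg_lim.
Qed.

End Poincare.

(** * Local primitives of several closed forms and dual coframes of commuting frames *)

Section ClosedForms.
Variable R : realType.

Lemma derive_sum_coord n (W : normedModType R) (f : 'rV[R]_n -> W) x v :
  differentiable f x -> 'D_v f x = \sum_i v 0 i *: 'D_(delta_mx 0 i) f x.
Proof.
move=> df; rewrite deriveE // [X in 'd f x X]row_sum_delta linear_sum.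
by apply: eq_bigr => i _; rewrite linearZ /= deriveE.
Qed.

(** Continuity bounds the finitely many partial derivatives near [x0]; linearity in the direction
    then gives a bound valid for all [v] at once. *)
Lemma local_bound n m p (A : set 'rV[R]_n) (B : 'rV[R]_n -> 'M[R]_(m, p)) x0 :
  open A -> A x0 -> C_k 1 A B -> exists d K, [/\ 0 < d, ball x0 d `<=` A,
    forall y, ball x0 d y -> `|B y| <= K &
    forall y v, ball x0 d y -> `|'D_v B y| <= K * `|v|].
Proof.
move=> oA Ax cB; have [dB cDB] := cB.
pose e i : 'rV[R]_n := delta_mx 0 i.
pose KD := \sum_i (`|'D_(e i) B x0| + 1).
have KD0 : 0 <= KD by apply: sumr_ge0 => i _; rewrite addr_ge0.
have nA : nbhs x0 A by exact: open_nbhs_nbhs.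
have nB : nbhs x0 [set y | `|B x0 - B y| < 1].
  by apply: continuous_dist_lt => //; exact: (C_kW cB).
have nD : nbhs x0 [set y | forall i, `|'D_(e i) B x0 - 'D_(e i) B y| < 1].
  apply: (@filter_forall _ _ (fun i y => `|'D_(e i) B x0 - 'D_(e i) B y| < 1) (nbhs x0)) => i.
  by apply: continuous_dist_lt => //; exact: cDB.
have : nbhs x0 (A `&` ([set y | `|B x0 - B y| < 1] `&`
  [set y | forall i, `|'D_(e i) B x0 - 'D_(e i) B y| < 1])).
  by apply: filterI => //; exact: filterI.
have near_le (W : normedModType R) (a b : W) : `|a - b| < 1 -> `|b| <= `|a| + 1.
  move=> ab; rewrite -{1}(subrK a b) (le_trans (ler_normD _ _)) // addrC.
  by rewrite lerD2l distrC ltW.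
move=> /nbhs_ballP[d /= d0 xd]; exists d, (`|B x0| + 1 + KD); split=> //.
- by move=> y /xd[].
- by move=> y /xd[_ [/near_le By _]]; rewrite ler_wpDr.
move=> y v /xd[Ay [_ Dy]]; rewrite derive_sum_coord; last exact: dB.
rewrite (le_trans (ler_norm_sum _ _ _)) // (@le_trans _ _ (KD * `|v|)) //.
  rewrite mulr_suml; apply: ler_sum => i _; rewrite normrZ mulrC ler_pM //.
    exact/near_le.
  exact: ler_mx_entry.
by rewrite ler_wpM2r // lerDr addr_ge0.
Qed.

(** Each column of [B] is a closed one-form with its own primitive; the common bound of [B] gives
    all of them the same ball. *)
Lemma exists_primitive n m (A : set 'rV[R]_n) (B : 'rV[R]_n -> 'M[R]_(n, m)) x0 :
  open A -> A x0 -> C_k 1 A B ->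
  (forall x u v, A x -> u *m 'D_v B x = v *m 'D_u B x) ->
  exists d (F : 'rV[R]_n -> 'rV[R]_m), [/\ 0 < d, ball x0 d `<=` A &
    forall x v, ball x0 d x -> is_derive x v F (v *m B x)].
Proof.
move=> oA Ax cB clB; have [d [K [d0 dA BK DK]]] := local_bound oA Ax cB.
have ob : open (ball x0 d) by exact: ball_open.
pose b a x := \col_i B x i a.
have cb a : C_k 1 (ball x0 d) (b a).
  apply/(C_k_mxP _ _ ob) => i j; have /(C_k_mxP _ _ ob) /(_ i a) := C_k_sub dA cB.
  by apply: C_k_ext => // x _; rewrite mxE.
have dB x v : ball x0 d x -> derivable B x v.
  by move=> /dA Axx; apply: diff_derivable; case: cB => + _; exact.
have Db a x v : ball x0 d x -> 'D_v (b a) x = \col_i ('D_v B x) i a.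
  move=> xd; rewrite derive_mx; last by apply: diff_derivable; case: (cb a) => + _; exact.
  apply/matrixP => i j; rewrite !mxE derive_entry; last exact: dB.
  by congr ('D_v _ x); apply/funext => y; rewrite mxE.
have col_le (M : 'M[R]_(n, m)) a : `|\col_i M i a| <= `|M|.
  by apply: mx_norm_le => // i j; rewrite mxE ler_mx_entry.
pose F x : 'rV[R]_m := \row_a primitive (b a) x0 x.
have dF x v : ball x0 d x -> forall a, is_derive x v (primitive (b a) x0) ((v *m b a x) 0 0).
  move=> xd a.
  have bK y : ball x0 d y -> `|b a y| <= K.
    by move=> yd; rewrite (le_trans (col_le _ _)) // BK.
  have DbK y w : ball x0 d y -> `|'D_w (b a) y| <= K * `|w|.
    by move=> yd; rewrite Db // (le_trans (col_le _ _)) // DK.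
  have bC y u w : ball x0 d y -> u *m 'D_w (b a) y = w *m 'D_u (b a) y.
    move=> yd; rewrite (Db a y w yd) (Db a y u yd); apply/matrixP => i j; rewrite !mxE.
    have /matrixP /(_ i a) := clB y u w (dA _ yd); rewrite !mxE => E.
    by under eq_bigr do rewrite mxE; rewrite E; apply: eq_bigr => l _; rewrite mxE.
  exact: (is_derive_primitive d0 (cb a) bK DbK bC v xd).
exists d, F; split=> // x v xd.
have dFx : derivable F x v.
  apply/derivable_mxP => i j; case: (dF x v xd j) => + _.
  by rewrite (_ : (fun y => F y i j) = primitive (b j) x0) //; apply/funext => y; rewrite mxE.
apply: DeriveDef => //; rewrite derive_mx //; apply/matrixP => i j.
rewrite mxE (_ : (fun y => F y i j) = primitive (b j) x0); last by apply/funext => y; rewrite mxE.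
rewrite (derive_val (is_derive := dF x v xd j)) !mxE ord1.
by apply: eq_bigr => l _; rewrite mxE.
Qed.

Lemma derive_invmx n (A : set 'rV[R]_n) (E : 'rV[R]_n -> 'M[R]_n) x v :
  open A -> A x -> (forall y, A y -> E y \in unitmx) -> C_k 1 A E ->
  'D_v (fun y => invmx (E y)) x = - (invmx (E x) *m 'D_v E x *m invmx (E x)).
Proof.
move=> oA Ax uE cE; have cB := C_k_invmx oA uE cE.
have dE : derivable E x v by apply: diff_derivable; case: cE => + _; exact.
have dB : derivable (fun y => invmx (E y)) x v by apply: diff_derivable; case: cB => + _; exact.
have : 'D_v (fun y => E y *m invmx (E y)) x = 0.
  rewrite (near_eq_derive _ (g := cst 1%:M)) ?derive_cst //.
  have : nbhs x A by exact: open_nbhs_nbhs.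
  by apply: filterS => y Ay; rewrite mulmxV // uE.
rewrite derive_mulmx // => /eqP; rewrite addrC addr_eq0 => /eqP.
move=> /(congr1 (mulmx (invmx (E x)))); rewrite mulmxA mulVmx ?uE // mul1mx => ->.
by rewrite mulmxN mulmxA.
Qed.

(* Rows of [E] are a frame; its dual coframe, the columns of the inverse, is
   closed because [d alpha (E_a, E_b) = - alpha [E_a, E_b]]. *)
Lemma closed_dual_coframe n (A : set 'rV[R]_n) (E : 'rV[R]_n -> 'M[R]_n) x u v :
  open A -> A x -> (forall y, A y -> E y \in unitmx) -> C_k 1 A E ->
  (forall a b, 'D_(row a (E x)) (fun y => row b (E y)) x =
               'D_(row b (E x)) (fun y => row a (E y)) x) ->
  u *m 'D_v (fun y => invmx (E y)) x = v *m 'D_u (fun y => invmx (E y)) x.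
Proof.
move=> oA Ax uE cE comm; 
(* With the derivative of the inverse inserted, both sides carry the same right factor
   [- invmx (E x)]. *)
suff H : u *m invmx (E x) *m 'D_v E x = v *m invmx (E x) *m 'D_u E x.
  by rewrite (derive_invmx v oA Ax uE cE) (derive_invmx u oA Ax uE cE) !mulmxN !mulmxA H.
have dE : differentiable E x by case: cE => + _; exact.
have dr a : differentiable (fun y => row a (E y)) x.
  apply: differentiable_mx => i j; have := differentiable_entry a j dE.
  by rewrite (_ : (fun y => E y a j) = fun y => (row a (E y)) i j) //; apply/funext => y; rewrite mxE.
have rowD a w : row a ('D_w E x) = 'D_w (fun y => row a (E y)) x.
  rewrite !derive_mx; [|exact: diff_derivable|exact: diff_derivable].
  by apply/rowP => j; rewrite !mxE; congr ('D_w _ x); apply/funext => y; rewrite mxE.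
(* In frame components [p], [q], the derivative of [E] becomes a combination of the derivatives of
   frame fields along frame fields, which [comm] makes symmetric. *)
have key p q : p *m 'D_(q *m E x) E x =
    \sum_a \sum_b (p 0 a * q 0 b) *: 'D_(row b (E x)) (fun y => row a (E y)) x.
  rewrite mulmx_sum_row; apply: eq_bigr => a _.
  rewrite rowD deriveE // [X in 'd _ _ X]mulmx_sum_row linear_sum scaler_sumr.
  by apply: eq_bigr => b _; rewrite linearZ /= scalerA deriveE.
have Eq (w : 'rV[R]_n) : w = w *m invmx (E x) *m E x by rewrite -mulmxA mulVmx ?uE // mulmx1.
have -> : 'D_v E x = 'D_(v *m invmx (E x) *m E x) E x by rewrite -Eq.
have -> : 'D_u E x = 'D_(u *m invmx (E x) *m E x) E x by rewrite -Eq.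
rewrite !key exchange_big /=; apply: eq_bigr => b _; apply: eq_bigr => a _.
by rewrite comm mulrC.
Qed.

End ClosedForms.

(** * Vector algebra and brackets of vector fields *)

Section Rows3.
Variable R : realType.
Implicit Types u v w : 'rV[R]_3.

Definition rows3 u v w : 'M[R]_3 := col_mx u (col_mx v w).

Lemma ord3P (i : 'I_3) : [\/ i = 0, i = 1 | i = 2].
Proof.
by case: i => [[|[|[|//]]]] Hi; [constructor 1|constructor 2|constructor 3]; exact: val_inj.
Qed.

Lemma rows3_0 u v w j : rows3 u v w 0 j = u 0 j.
Proof.
have -> : (0 : 'I_3) = lshift 2 (0 : 'I_1) by exact: val_inj.
exact: (col_mxEu u (col_mx v w)).
Qed.

Lemma rows3_1 u v w j : rows3 u v w 1 j = v 0 j.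
Proof.
have -> : (1 : 'I_3) = rshift 1 (lshift 1 (0 : 'I_1)) by exact: val_inj.
exact: etrans (col_mxEd u (col_mx v w) _ j) (col_mxEu v w 0 j).
Qed.

Lemma rows3_2 u v w j : rows3 u v w 2 j = w 0 j.
Proof.
have -> : (2 : 'I_3) = rshift 1 (rshift 1 (0 : 'I_1)) by exact: val_inj.
exact: etrans (col_mxEd u (col_mx v w) _ j) (col_mxEd v w 0 j).
Qed.

Definition rows3E := (rows3_0, rows3_1, rows3_2).

Lemma row_rows3 u v w :
  [/\ row 0 (rows3 u v w) = u, row 1 (rows3 u v w) = v & row 2 (rows3 u v w) = w].
Proof. by split; apply/rowP => j; rewrite mxE rows3E. Qed.

Lemma sum3 (V : nmodType) (F : 'I_3 -> V) : \sum_i F i = F 0 + F 1 + F 2.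
Proof.
rewrite !big_ord_recl big_ord0 addr0 addrA; congr (F _ + F _ + F _); exact: val_inj.
Qed.

Lemma det_mx22 (A : 'M[R]_2) : \det A = A 0 0 * A 1 1 - A 0 1 * A 1 0.
Proof.
rewrite (expand_det_row _ 0) !big_ord_recl big_ord0 addr0 /cofactor !det_mx11 !mxE /=.
rewrite (_ : lift 0 0 = 1 :> 'I_2); last exact: val_inj.
rewrite (_ : lift 1 0 = 0 :> 'I_2); last exact: val_inj.
by rewrite /= ?addn0 ?add0n expr0 expr1; ring.
Qed.

Lemma det_mx33 (A : 'M[R]_3) : \det A =
  A 0 0 * (A 1 1 * A 2 2 - A 1 2 * A 2 1) - A 0 1 * (A 1 0 * A 2 2 - A 1 2 * A 2 0)
  + A 0 2 * (A 1 0 * A 2 1 - A 1 1 * A 2 0).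
Proof.
rewrite (expand_det_row _ 0) sum3 /cofactor !det_mx22 !mxE /=.
rewrite (_ : lift 0 0 = 1 :> 'I_3); last exact: val_inj.
rewrite (_ : lift 0 1 = 2 :> 'I_3); last exact: val_inj.
rewrite (_ : lift 1 0 = 0 :> 'I_3); last exact: val_inj.
rewrite (_ : lift 1 1 = 2 :> 'I_3); last exact: val_inj.
rewrite (_ : lift 2 0 = 0 :> 'I_3); last exact: val_inj.
rewrite (_ : lift 2 1 = 1 :> 'I_3); last exact: val_inj.
by rewrite /= ?addn0 ?add0n expr0 expr1 expr2; ring.
Qed.

Definition det3 u v w := \det (rows3 u v w).

Lemma det3E u v w : det3 u v w =
  u 0 0 * (v 0 1 * w 0 2 - v 0 2 * w 0 1) - u 0 1 * (v 0 0 * w 0 2 - v 0 2 * w 0 0)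
  + u 0 2 * (v 0 0 * w 0 1 - v 0 1 * w 0 0).
Proof. by rewrite /det3 det_mx33 !rows3E. Qed.

Definition ip (G : 'M[R]_3) u v : R := (u *m G *m v^T) 0 0.

Lemma ipDl G u v w : ip G (u + v) w = ip G u w + ip G v w.
Proof. by rewrite /ip !mulmxDl mxE. Qed.
Lemma ipDr G u v w : ip G u (v + w) = ip G u v + ip G u w.
Proof. by rewrite /ip linearD /= mulmxDr mxE. Qed.
Lemma ipZl G a u v : ip G (a *: u) v = a * ip G u v.
Proof. by rewrite /ip -!scalemxAl mxE. Qed.
Lemma ipZr G a u v : ip G u (a *: v) = a * ip G u v.
Proof. by rewrite /ip linearZ /= -scalemxAr mxE. Qed.
Lemma ipNl G u v : ip G (- u) v = - ip G u v.
Proof. by rewrite -scaleN1r ipZl mulN1r. Qed.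
Lemma ipNr G u v : ip G u (- v) = - ip G u v.
Proof. by rewrite -scaleN1r ipZr mulN1r. Qed.
Lemma ipC G u v : G^T = G -> ip G u v = ip G v u.
Proof.
move=> GT; have E : (u *m G *m v^T)^T = v *m G *m u^T.
  by rewrite !trmx_mul trmxK GT mulmxA.
by rewrite /ip -E [RHS]mxE.
Qed.

Lemma ip_unit_orthogonal G u v w a b d : G^T = G ->
  ip G u u = 1 -> ip G u v = 0 -> ip G u w = 0 ->
  ip G (a *: u + b *: v + d *: w) (a *: u + b *: v + d *: w) =
  a ^+ 2 + ip G v v * b ^+ 2 + 2 * ip G v w * (b * d) + ip G w w * d ^+ 2.
Proof.
move=> GT uu uv uw; rewrite !(ipDl, ipDr, ipZl, ipZr).
by rewrite (ipC v u GT) (ipC w u GT) (ipC w v GT) uu uv uw; ring.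
Qed.

(** Both sides are the determinant of the Gram matrix of the three vectors, which is block diagonal
    by orthogonality. *)
Lemma gram_det G u v w : G^T = G -> ip G u v = 0 -> ip G u w = 0 ->
  det3 u v w ^+ 2 * \det G = ip G u u * (ip G v v * ip G w w - ip G v w * ip G v w).
Proof.
move=> GT uv uw; pose M := rows3 u v w.
have -> : det3 u v w ^+ 2 * \det G = \det (M *m G *m M^T).
  by rewrite !det_mulmx det_tr /det3 -/M; ring.
have E i j : (M *m G *m M^T) i j = ip G (row i M) (row j M).
  by rewrite /ip -row_mul !mxE; apply: eq_bigr => k _; rewrite !mxE.
have [r0 r1 r2] := row_rows3 u v w.
rewrite det_mx33 !E r0 r1 r2 (ipC v u GT) (ipC w u GT) (ipC w v GT) uv uw; ring.
Qed.

Lemma posdef_unit (G : 'M[R]_3) : (forall v, v != 0 -> 0 < ip G v v) -> G \in unitmx.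
Proof.
move=> pG; rewrite unitmxE unitfE; apply/negP => /det0P[v v0 vG].
by have := pG v v0; rewrite /ip vG mul0mx mxE ltxx.
Qed.

Lemma posdef_eq0 (G : 'M[R]_3) u : (forall v, v != 0 -> 0 < ip G v v) ->
  ip G u u = 0 -> u = 0.
Proof.
move=> pG uu; apply/eqP; case: eqVneq => // u0.
by have := pG u u0; rewrite uu ltxx.
Qed.

(** The vectors orthogonal to both form the left kernel of a 3-by-2 matrix, whose rank is at most
    2. *)
Lemma exists_orthogonal (G : 'M[R]_3) u v : exists2 w, w != 0 & ip G w u = 0 /\ ip G w v = 0.
Proof.
pose M := G *m (col_mx u v)^T.
have kM : kermx M != 0.
  rewrite kermx_eq0 /row_free; apply/negP => /eqP E.
  by have := rank_leq_col M; rewrite E.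
exists (nz_row (kermx M)); first by rewrite nz_row_eq0.
have /sub_kermxP := nz_row_sub (kermx M).
rewrite /M tr_col_mx mul_mx_row mul_mx_row => /eqP; rewrite row_mx_eq0 !mulmxA => /andP[/eqP a /eqP b].
by rewrite /ip a b !mxE.
Qed.

(** For an orthogonal triple of nonzero vectors the Gram determinant is positive, and it is [\det G]
    times a square. *)
Lemma posdef_det_gt0 (G : 'M[R]_3) : G^T = G -> (forall v, v != 0 -> 0 < ip G v v) ->
  0 < \det G.
Proof.
move=> GT pG; pose v : 'rV[R]_3 := delta_mx 0 0.
have v0 : v != 0.
  by apply/eqP => /rowP /(_ 0); rewrite !mxE /= => /eqP; rewrite oner_eq0.
have [u u0 [uv _]] := exists_orthogonal G v v.
have [w w0 [wu wv]] := exists_orthogonal G u v.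
have := gram_det GT wu wv; rewrite uv mulr0 subr0 => E.
have : 0 < det3 w u v ^+ 2 * \det G by rewrite E !mulr_gt0 // pG.
by move=> H; have := sqr_ge0 (det3 w u v); nra.
Qed.

End Rows3.

(** * Derivatives along vector fields and the Lie bracket on an open set *)

Section FieldCalculus.
Variables (R : realType) (n : nat) (S : set 'rV[R]_n).
Hypothesis oS : open S.

Lemma smooth_differentiable (W : normedModType R) (f : 'rV[R]_n -> W) x :
  smooth_on S f -> S x -> differentiable f x.
Proof. by move=> sf Sx; case: (sf 1%N) => + _; exact. Qed.

Lemma smooth_derivable (W : normedModType R) (f : 'rV[R]_n -> W) x v :
  smooth_on S f -> S x -> derivable f x v.
Proof. by move=> sf Sx; exact/diff_derivable/smooth_differentiable. Qed.

Lemma near_derive (W : normedModType R) (f h : 'rV[R]_n -> W) x v :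
  S x -> (forall y, S y -> f y = h y) -> 'D_v f x = 'D_v h x.
Proof.
move=> Sx fh; apply: near_eq_derive.
have : nbhs x S by exact: open_nbhs_nbhs.
by apply: filterS => y /fh.
Qed.

Lemma derive_const_on (W : normedModType R) (f : 'rV[R]_n -> W) (w : W) x v :
  S x -> (forall y, S y -> f y = w) -> 'D_v f x = 0.
Proof. by move=> Sx fw; rewrite (near_derive (h := cst w)) ?derive_cst. Qed.

Lemma smooth_derive (W : normedModType R) (f : 'rV[R]_n -> W) v :
  smooth_on S f -> smooth_on S ('D_v f).
Proof. by move=> sf k; case: (sf k.+1) => _; exact. Qed.

Definition grad (f : 'rV[R]_n -> R) x : 'cV[R]_n := \col_i 'D_(delta_mx 0 i) f x.

Lemma gradE f x v : differentiable f x -> 'D_v f x = (v *m grad f x) 0 0.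
Proof.
by move=> df; rewrite derive_sum_coord // mxE; apply: eq_bigr => i _; rewrite mxE.
Qed.

Lemma smooth_grad f : smooth_on S f -> smooth_on S (grad f).
Proof.
move=> sf k; apply/(C_k_mxP _ _ oS) => i j.
apply: (C_k_ext oS) (smooth_derive (delta_mx 0 i) sf k).
by move=> x _; rewrite mxE.
Qed.

Lemma smooth_mulmx m p q (f : 'rV[R]_n -> 'M[R]_(m, p)) (h : 'rV[R]_n -> 'M[R]_(p, q)) :
  smooth_on S f -> smooth_on S h -> smooth_on S (fun x => f x *m h x).
Proof. by move=> sf sh k; exact: C_k_mulmx. Qed.

Lemma smooth_cst (W : normedModType R) (w : W) : smooth_on S (fun=> w).
Proof. by move=> k; exact: C_k_cst. Qed.

Lemma smooth_tr m p (f : 'rV[R]_n -> 'M[R]_(m, p)) :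
  smooth_on S f -> smooth_on S (fun x => (f x)^T).
Proof.
move=> sf k; apply/(C_k_mxP _ _ oS) => i j; have /(C_k_mxP _ _ oS) /(_ j i) := sf k.
by apply: C_k_ext => // x _; rewrite mxE.
Qed.

Lemma smooth_entry m p (f : 'rV[R]_n -> 'M[R]_(m, p)) i j :
  smooth_on S f -> smooth_on S (fun x => f x i j).
Proof. by move=> sf k; have /(C_k_mxP _ _ oS) := sf k. Qed.

Lemma smooth_scale m p (r : 'rV[R]_n -> R) (f : 'rV[R]_n -> 'M[R]_(m, p)) :
  smooth_on S r -> smooth_on S f -> smooth_on S (fun x => r x *: f x).
Proof.
move=> sr sf k; apply/(C_k_mxP _ _ oS) => i j.
apply: (C_k_ext oS) (C_kM oS (sr k) (smooth_entry i j sf k)) => x _.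
by rewrite mxE.
Qed.

Lemma derive_scale m p (r : 'rV[R]_n -> R) (f : 'rV[R]_n -> 'M[R]_(m, p)) x v :
  derivable r x v -> derivable f x v ->
  'D_v (fun x => r x *: f x) x = 'D_v r x *: f x + r x *: 'D_v f x.
Proof.
move=> dr df; have dfe := (derivable_mxP _ _ _).1 df.
have dE i j : derivable (fun y => (r y *: f y) i j) x v.
  rewrite (_ : (fun y => _) = r * (fun y => f y i j)); first exact: derivableM.
  by apply/funext => y; rewrite mxE.
rewrite derive_mx; last by apply/derivable_mxP.
apply/matrixP => i j; rewrite !mxE.
rewrite (_ : (fun y => _) = r * (fun y => f y i j)); last by apply/funext => y; rewrite mxE.
by rewrite deriveM // derive_entry // addrC; congr (_ + _); rewrite mulrC.
Qed.

Lemma second_derive_grad (f : 'rV[R]_n -> R) x u w : smooth_on S f -> S x ->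
  (u *m 'D_w (grad f) x) 0 0 = 'D_w ('D_u f) x.
Proof.
move=> sf Sx; have sg := smooth_grad sf.
have dg : derivable (grad f) x w by exact: smooth_derivable.
rewrite (near_derive (f := 'D_u f) (h := fun y => (u *m grad f y) 0 0)) //; last first.
  by move=> y Sy; rewrite gradE //; exact: smooth_differentiable.
rewrite -derive_entry; last by apply: derivable_mulmx => //; exact: derivable_cst.
by rewrite derive_mulmx // ?derive_cst ?mul0mx ?add0r //; exact: derivable_cst.
Qed.

(** The product rule for the pairing of [P] with [grad f]: one term for the moving direction, one
    for the second derivative of [f]. *)
Lemma derive_along (f : 'rV[R]_n -> R) (P : 'rV[R]_n -> 'rV[R]_n) x w : smooth_on S f -> smooth_on S P -> S x ->
  'D_w (fun y => 'D_(P y) f y) x = 'D_('D_w P x) f x + 'D_w ('D_(P x) f) x.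
Proof.
move=> sf sP Sx; have sg := smooth_grad sf.
rewrite (near_derive (h := fun y => (P y *m grad f y) 0 0)) //; last first.
  by move=> y Sy; rewrite gradE //; exact: smooth_differentiable.
have dP : derivable P x w by exact: smooth_derivable.
have dg : derivable (grad f) x w by exact: smooth_derivable.
rewrite -derive_entry; last exact: derivable_mulmx.
rewrite derive_mulmx // mxE second_derive_grad // -gradE //.
exact: smooth_differentiable.
Qed.

Definition bracket (Y P : 'rV[R]_n -> 'rV[R]_n) x := 'D_(Y x) P x - 'D_(P x) Y x.

Lemma derive_subv (W : normedModType R) (f : 'rV[R]_n -> W) x u v :
  differentiable f x -> 'D_(u - v) f x = 'D_u f x - 'D_v f x.
Proof. by move=> df; rewrite (deriveE _ df) linearB /= -(deriveE _ df) -(deriveE _ df). Qed.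

Lemma derive_comb3 (f : 'rV[R]_n -> R) x u v w a b d : differentiable f x ->
  'D_(a *: u + b *: v + d *: w) f x = a * 'D_u f x + b * 'D_v f x + d * 'D_w f x.
Proof. by move=> df; rewrite !(deriveE _ df) !linearD !linearZ. Qed.

(** The second derivatives of [f] cancel by [deriveC]; only the derivatives of the fields remain. *)
Lemma derive_bracket (f : 'rV[R]_n -> R) Y P x :
  smooth_on S f -> smooth_on S Y -> smooth_on S P -> S x ->
  'D_(Y x) (fun y => 'D_(P y) f y) x - 'D_(P x) (fun y => 'D_(Y y) f y) x =
  'D_(bracket Y P x) f x.
Proof.
move=> sf sY sP Sx.
rewrite (derive_along (Y x) sf sP Sx) (derive_along (P x) sf sY Sx).
rewrite (deriveC (x := x) (Y x) (P x) oS (sf 2%N) Sx) /bracket.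
have df := smooth_differentiable sf Sx.
have cancel (a b c : R) : a + c - (b + c) = a - b by ring.
rewrite (derive_subv _ _ df); exact: cancel.
Qed.

End FieldCalculus.

(** * The commuting frame of two Killing fields *)

Section KillingFrame.
Variables (R : realType) (S : set 'rV[R]_3).
Variables (g : 'rV[R]_3 -> 'M[R]_3) (s : 'rV[R]_3 -> R) (X Z : 'rV[R]_3 -> 'rV[R]_3).

(** The Lie derivative of the metric along [Y], evaluated on constant fields [u], [v]; it involves
    no Christoffel symbols. *)
Definition lie_killing (Y : 'rV[R]_3 -> 'rV[R]_3) := forall x, S x -> forall u v,
  ip ('D_(Y x) g x) u v + ip (g x) ('D_u Y x) v + ip (g x) u ('D_v Y x) = 0.

Hypotheses (oS : open S) (sg : smooth_on S g) (sX : smooth_on S X) (sZ : smooth_on S Z).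
Hypothesis gT : forall x, S x -> (g x)^T = g x.
Hypothesis gpos : forall x, S x -> forall v, v != 0 -> 0 < ip (g x) v v.
Hypotheses (KX : lie_killing X) (KZ : lie_killing Z).
(** [s] is the Riemannian density, so [s x * det3 u v w] is the volume form. *)
Hypothesis s_gt0 : forall x, S x -> 0 < s x.
Hypothesis s_sqr : forall x, S x -> s x ^+ 2 = \det (g x).
(* [2 Z] is the curl of [X]. *)
Hypothesis dflat : forall x, S x -> forall u v,
  ('D_u (fun y => X y *m g y) x *m v^T) 0 0 - ('D_v (fun y => X y *m g y) x *m u^T) 0 0 =
  s x * det3 (2 *: Z x) u v.
Hypothesis indep : forall x, S x -> forall a b, a *: X x + b *: Z x = 0 -> a = 0 /\ b = 0.

Lemma smooth_ip P Q : smooth_on S P -> smooth_on S Q ->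
  smooth_on S (fun y => ip (g y) (P y) (Q y)).
Proof.
move=> sP sQ; apply: (smooth_entry oS 0 0).
by apply: smooth_mulmx => //; [exact: smooth_mulmx|exact: smooth_tr].
Qed.

Lemma derive_ip P Q x w : smooth_on S P -> smooth_on S Q -> S x ->
  'D_w (fun y => ip (g y) (P y) (Q y)) x =
  ip (g x) ('D_w P x) (Q x) + ip (g x) (P x) ('D_w Q x) + ip ('D_w g x) (P x) (Q x).
Proof.
move=> sP sQ Sx.
have dP : derivable P x w by exact: smooth_derivable sP Sx.
have dQ : derivable Q x w by exact: smooth_derivable sQ Sx.
have dg : derivable g x w by exact: smooth_derivable sg Sx.
have dPg : derivable (fun y => P y *m g y) x w by exact: derivable_mulmx.
have dQT : derivable (fun y => (Q y)^T) x w by exact: derivable_tr.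
rewrite /ip -derive_entry; last exact: derivable_mulmx.
rewrite derive_mulmx // derive_mulmx // derive_tr // mulmxDl !mxE.
by rewrite addrAC.
Qed.

(** The Killing equation trades the derivative of the metric for exactly the terms that complete the
    derivatives of [P] and [Q] along [Y] to brackets. *)
Lemma killing_leibniz Y P Q x : lie_killing Y ->
  smooth_on S P -> smooth_on S Q -> S x ->
  'D_(Y x) (fun y => ip (g y) (P y) (Q y)) x =
  ip (g x) (bracket Y P x) (Q x) + ip (g x) (P x) (bracket Y Q x).
Proof.
move=> KY sP sQ Sx; rewrite derive_ip // /bracket ipDl ipDr ipNl ipNr.
have := KY x Sx (P x) (Q x); lra.
Qed.

(** [h1] is twice the function f of the overview; this is the origin of the factors 2 and of the
    half in [n]. *)
Let h1 x := ip (g x) (X x) (X x).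
Let h2 x := ip (g x) (X x) (Z x).
Let h3 x := ip (g x) (Z x) (Z x).
Let gram x := h1 x * h3 x - h2 x * h2 x.

Let sh1 : smooth_on S h1. Proof. exact: smooth_ip. Qed.
Let sh2 : smooth_on S h2. Proof. exact: smooth_ip. Qed.
Let sh3 : smooth_on S h3. Proof. exact: smooth_ip. Qed.

Lemma X_neq0 x : S x -> X x != 0.
Proof.
move=> Sx; apply/negP => /eqP X0; have [|/eqP + _] := indep Sx (a := 1) (b := 0).
  by rewrite X0 scaler0 scale0r addr0.
by rewrite oner_eq0.
Qed.

Lemma h1_gt0 x : S x -> 0 < h1 x.
Proof. by move=> Sx; exact/gpos/X_neq0. Qed.

(** The vector [h1 x *: Z x - h2 x *: X x] is nonzero, and its squared length is [h1 x * gram x]. *)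
Lemma gram_gt0 x : S x -> 0 < gram x.
Proof.
move=> Sx; have h0 := h1_gt0 Sx.
have yn0 : h1 x *: Z x - h2 x *: X x != 0.
  apply/negP => /eqP E; have [|_ H] := indep Sx (a := - h2 x) (b := h1 x).
    by rewrite scaleNr addrC.
  by rewrite H ltxx in h0.
have := gpos Sx yn0; rewrite !(ipDl, ipDr, ipNl, ipNr, ipZl, ipZr).
rewrite (ipC (Z x) (X x) (gT Sx)) -/(h1 x) -/(h2 x) -/(h3 x).
have -> : h1 x * (h1 x * h3 x - h2 x * h2 x) + (h1 x * - (h2 x * h2 x) - h2 x * - (h2 x * h1 x)) =
  h1 x * gram x by rewrite /gram; ring.
by rewrite pmulr_rgt0.
Qed.

(** Cartan's formula: X annihilates its own dual form, so d|X|^2 is minus the contraction of d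
    X^flat with X. In coordinates, the Killing equation at [(X x, v)] is added to [dflat] at
    [(v, X x)]. *)
Lemma derive_h1 x v : S x -> 'D_v h1 x = 2 * (s x * det3 v (X x) (Z x)).
Proof.
move=> Sx; rewrite /h1 derive_ip //.
have := dflat Sx v (X x); have := KX Sx (X x) v.
have dX w : derivable X x w by exact: smooth_derivable sX Sx.
have dg w : derivable g x w by exact: smooth_derivable sg Sx.
have DXg w u : ('D_w (fun y => X y *m g y) x *m u^T) 0 0 =
    ip (g x) ('D_w X x) u + ip ('D_w g x) (X x) u.
  by rewrite (derive_mulmx (dX w) (dg w)) mulmxDl mxE.
rewrite (DXg v) (DXg (X x)).
have -> : det3 (2 *: Z x) v (X x) = 2 * det3 v (X x) (Z x).
  by rewrite !det3E !mxE; ring.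
lra.
Qed.

Lemma derive_h1X x : S x -> 'D_(X x) h1 x = 0.
Proof. by move=> Sx; rewrite derive_h1 // det3E; ring. Qed.

Lemma derive_h1Z x : S x -> 'D_(Z x) h1 x = 0.
Proof. by move=> Sx; rewrite derive_h1 // det3E; ring. Qed.

Let n x : 'rV[R]_3 := (2^-1 *: (grad h1 x)^T) *m invmx (g x).

Let sn : smooth_on S n.
Proof.
have ug x : S x -> g x \in unitmx by move=> Sx; exact/posdef_unit/gpos.
apply: smooth_mulmx => //.
  apply: smooth_scale => //; first exact: smooth_cst.
  by apply: smooth_tr => //; exact: smooth_grad.
by move=> k; exact: C_k_invmx (sg k).
Qed.

Lemma ip_n x v : S x -> ip (g x) (n x) v = 2^-1 * 'D_v h1 x.
Proof.
move=> Sx; have ug : g x \in unitmx by exact/posdef_unit/gpos.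
rewrite (gradE v (smooth_differentiable sh1 Sx)) /ip /n -!mulmxA (mulmxA (invmx _)).
rewrite mulVmx // mul1mx -scalemxAl mxE; congr (_ * _).
by rewrite -[in LHS](trmxK (v^T)) -trmx_mul mxE trmxK.
Qed.

(** This identifies [n] as the cross product of [X] and [Z]. *)
Lemma ip_nE x v : S x -> ip (g x) (n x) v = s x * det3 v (X x) (Z x).
Proof. by move=> Sx; rewrite ip_n // derive_h1 // mulKf // pnatr_eq0. Qed.

(** The bracket is frozen at [x] to a constant field [cv] and used as its own test vector. Since
    [ip_n] expresses the pairing with [n] by derivatives of [h1], and [Y] kills [h1], the Leibniz
    rule leaves its squared length equal to 0. *)
Lemma bracket_n Y x : lie_killing Y -> smooth_on S Y ->
  (forall y, S y -> 'D_(Y y) h1 y = 0) -> S x -> bracket Y n x = 0.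
Proof.
move=> KY sY Yh1 Sx; apply: (posdef_eq0 (gpos Sx)); set v := bracket Y n x.
pose cv := fun _ : 'rV[R]_3 => v; have scv : smooth_on S cv by exact: smooth_cst.
have := killing_leibniz KY sn scv Sx.
rewrite (near_derive oS (h := fun y => 2^-1 * 'D_v h1 y)) //; last by move=> y Sy; rewrite ip_n.
have dv : derivable ('D_v h1) x (Y x).
  exact: smooth_derivable (smooth_derive v sh1) Sx.
have -> : 'D_(Y x) (fun y => 2^-1 * 'D_v h1 y) x = 2^-1 * 'D_(Y x) ('D_v h1) x.
  exact: deriveZ.
have := derive_bracket oS sh1 sY scv Sx.
rewrite (derive_const_on oS (w := 0) v Sx Yh1) subr0 => ->.
rewrite (ip_n (bracket Y cv x) Sx) => E.
have : ip (g x) v v + 2^-1 * 'D_(bracket Y cv x) h1 x = 2^-1 * 'D_(bracket Y cv x) h1 x by rewrite -E.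
lra.
Qed.

Lemma ip_nX x : S x -> ip (g x) (n x) (X x) = 0.
Proof. by move=> Sx; rewrite ip_n // derive_h1X // mulr0. Qed.

Lemma ip_nZ x : S x -> ip (g x) (n x) (Z x) = 0.
Proof. by move=> Sx; rewrite ip_n // derive_h1Z // mulr0. Qed.

(** Otherwise vol (w, X, Z) would vanish for a nonzero [w] orthogonal to [X] and [Z], against
    [gram_det]. *)
Lemma n_neq0 x : S x -> n x != 0.
Proof.
move=> Sx; apply/negP => /eqP n0.
have [w w0 [wX wZ]] := exists_orthogonal (g x) (X x) (Z x).
have := gram_det (gT Sx) wX wZ.
have : s x * det3 w (X x) (Z x) = 0 by rewrite -ip_nE // n0 /ip !mul0mx mxE.
move/eqP; rewrite mulf_eq0 gt_eqF ?s_gt0 //= => /eqP ->.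
rewrite expr0n mul0r => /esym/eqP; rewrite mulf_eq0 !gt_eqF //; first exact: gram_gt0.
exact: gpos.
Qed.

(** By [ip_nE], the left side of [gram_det] for [n], [X], [Z] is the square of |n|^2; one factor
    |n|^2 is cancelled. *)
Lemma ip_nn x : S x -> ip (g x) (n x) (n x) = gram x.
Proof.
move=> Sx; have nn0 := gpos Sx (n_neq0 Sx).
have := gram_det (gT Sx) (ip_nX Sx) (ip_nZ Sx).
rewrite -s_sqr // -exprMn [det3 _ _ _ * _]mulrC -ip_nE // expr2.
by move/(mulfI (lt0r_neq0 nn0)).
Qed.

Lemma bracket_XX x : bracket X X x = 0. Proof. by rewrite /bracket subrr. Qed.
Lemma bracketC (Y P : 'rV[R]_3 -> 'rV[R]_3) x : bracket Y P x = - bracket P Y x.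
Proof. by rewrite /bracket opprB. Qed.

Lemma ip0l u x : ip (g x) 0 u = 0. Proof. by rewrite /ip !mul0mx mxE. Qed.
Lemma ip0r u x : ip (g x) u 0 = 0. Proof. by rewrite /ip trmx0 mulmx0 mxE. Qed.

Lemma derive_gram Y x : lie_killing Y -> smooth_on S Y ->
  (forall y, S y -> 'D_(Y y) h1 y = 0) -> S x -> 'D_(Y x) gram x = 0.
Proof.
move=> KY sY Yh1 Sx.
rewrite (near_derive oS (h := fun y => ip (g y) (n y) (n y))) //; last by move=> y Sy; rewrite ip_nn.
by rewrite killing_leibniz // bracket_n // ip0l ip0r addr0.
Qed.

(** The bracket [Y] is orthogonal to a basis. Against [n]: both fields kill [h1]. Against [X]: the
    derivative of [h1] along [Z] is -2 <Y, X>. Against [Z]: once the derivatives of [h1] and [h2]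
    along [X] vanish, that of [gram] is 2 [h1] <Y, Z>, and it is 0 by [derive_gram]. *)
Lemma bracket_XZ x : S x -> bracket X Z x = 0.
Proof.
move=> Sx; set Y := bracket X Z x.
have Yn : ip (g x) (n x) Y = 0.
  rewrite ip_n // -(derive_bracket oS sh1 sX sZ Sx).
  by rewrite !(derive_const_on oS (w := 0)) ?subrr ?mulr0 // => y Sy; [exact: derive_h1X|exact: derive_h1Z].
have YX : ip (g x) Y (X x) = 0.
  have := derive_h1Z Sx; rewrite killing_leibniz // bracketC -/Y ipNl ipNr (ipC _ Y (gT Sx)).
  lra.
have Xh2 : 'D_(X x) h2 x = 0.
  rewrite killing_leibniz // bracket_XX ip0l add0r -/Y ipC ?gT //.
have Xh3 : 'D_(X x) h3 x = 2 * ip (g x) Y (Z x).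
  by rewrite killing_leibniz // -/Y (ipC (Z x) Y (gT Sx)); ring.
have YZ : ip (g x) Y (Z x) = 0.
  have := derive_gram KX sX derive_h1X Sx.
  have d1 : derivable h1 x (X x) by exact: smooth_derivable sh1 Sx.
  have d2 : derivable h2 x (X x) by exact: smooth_derivable sh2 Sx.
  have d3 : derivable h3 x (X x) by exact: smooth_derivable sh3 Sx.
  rewrite (derive_sub (derivable_mul d1 d3) (derivable_mul d2 d2)).
  rewrite (derive_mul d1 d3) (derive_mul d2 d2) Xh2 Xh3 (derive_h1X Sx).
  rewrite mul0r mulr0 mul0r add0r addr0 subr0.
  move=> /eqP; rewrite mulf_eq0 (gt_eqF (h1_gt0 Sx)) /= mulf_eq0 pnatr_eq0 /=.
  by move/eqP.
have uN : rows3 (n x) (X x) (Z x) \in unitmx.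
  rewrite unitmxE unitfE -/(det3 _ _ _); apply/negP => /eqP D0.
  have := gpos Sx (n_neq0 Sx); rewrite (ip_nE _ Sx) D0 mulr0 ltxx //.
have : rows3 (n x) (X x) (Z x) *m (g x *m Y^T) = 0.
  apply/matrixP => i j; rewrite ord1 [RHS]mxE.
  have [r0 r1 r2] := row_rows3 (n x) (X x) (Z x).
  have E : (rows3 (n x) (X x) (Z x) *m (g x *m Y^T)) i 0 = ip (g x) (row i (rows3 (n x) (X x) (Z x))) Y.
    by rewrite /ip -mulmxA -row_mul [RHS]mxE.
  rewrite E; case: (ord3P i) => ->; rewrite ?r0 ?r1 ?r2 //.
    by rewrite ipC ?gT.
  by rewrite ipC ?gT.
move=> /(congr1 (mulmx (invmx (rows3 (n x) (X x) (Z x))))); rewrite mulKmx // mulmx0 => E.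
by apply: (posdef_eq0 (gpos Sx)); rewrite /ip -mulmxA E mulmx0 mxE.
Qed.

Let rho x := (Num.sqrt (gram x))^-1.

Let sgram : smooth_on S gram.
Proof.
move=> k; apply: (C_k_ext oS)
  (_ : C_k k S (fun x => h1 x * h3 x + - (h2 x * h2 x))) => //.
apply: (C_kD oS); first by apply: (C_kM oS).
by apply: (C_kN oS); apply: (C_kM oS).
Qed.

Let rho_gt0 x : S x -> 0 < rho x.
Proof. by move=> Sx; rewrite invr_gt0 sqrtr_gt0 gram_gt0. Qed.

Let srho : smooth_on S rho.
Proof.
move=> k; apply: (C_kV oS); last by apply: (C_k_sqrt oS) => //; exact: gram_gt0.
by move=> x Sx; rewrite gt_eqF // sqrtr_gt0 gram_gt0.
Qed.

Let rho_sqr x : S x -> rho x * rho x * gram x = 1.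
Proof.
move=> Sx; have g0 := gram_gt0 Sx; rewrite /rho -invfM -expr2 sqr_sqrtr ?ltW //.
by rewrite mulVf // gt_eqF.
Qed.

(** Differentiating [rho * rho * gram = 1] bypasses the derivative of the square root. *)
Lemma derive_rho Y x : lie_killing Y -> smooth_on S Y ->
  (forall y, S y -> 'D_(Y y) h1 y = 0) -> S x -> 'D_(Y x) rho x = 0.
Proof.
move=> KY sY Yh1 Sx; have Dg := derive_gram KY sY Yh1 Sx.
have dr : derivable rho x (Y x) by exact: smooth_derivable srho Sx.
have dg : derivable gram x (Y x) by exact: smooth_derivable sgram Sx.
have := derive_const_on oS (f := fun y => rho y * rho y * gram y) (w := 1) (Y x) Sx rho_sqr.
rewrite (derive_mul (derivable_mul dr dr) dg) (derive_mul dr dr) Dg mulr0 addr0.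
rewrite [rho x * _]mulrC -mulr2n => /eqP.
rewrite mulf_eq0 (gt_eqF (gram_gt0 Sx)) orbF mulrn_eq0 /= mulf_eq0 (gt_eqF (rho_gt0 Sx)) orbF.
by move/eqP.
Qed.

Let N x : 'rV[R]_3 := rho x *: n x.

Let sN : smooth_on S N. Proof. exact: smooth_scale. Qed.

Lemma bracket_N Y x : lie_killing Y -> smooth_on S Y ->
  (forall y, S y -> 'D_(Y y) h1 y = 0) -> S x -> 'D_(Y x) N x = 'D_(N x) Y x.
Proof.
move=> KY sY Yh1 Sx.
have dr : derivable rho x (Y x) by exact: smooth_derivable srho Sx.
have dn : derivable n x (Y x) by exact: smooth_derivable sn Sx.
rewrite (derive_scale dr dn) derive_rho // scale0r add0r.
have dY := smooth_differentiable sY Sx.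
rewrite [RHS](deriveE _ dY) /N linearZ /= -(deriveE _ dY).
by have /eqP := bracket_n KY sY Yh1 Sx; rewrite subr_eq0 => /eqP ->.
Qed.

Lemma derive_h2 x w : S x -> [\/ w = N x, w = X x | w = Z x] -> 'D_w h2 x = 0.
Proof.
move=> Sx [] ->.
(* N<X, Z> - Z<X, N> = d X^flat (N, Z) + <X, [N, Z]>. Here <X, N> is identically 0, [N] and [Z]
   commute, and the curl 2 Z annihilates the form on the pair (N, Z). *)
- have dX w' : derivable (fun y => X y *m g y) x w'.
    by apply: derivable_mulmx; [exact: smooth_derivable sX Sx|exact: smooth_derivable sg Sx].
  have dP P w' : smooth_on S P ->
     'D_w' (fun y => ip (g y) (X y) (P y)) x =
     ('D_w' (fun y => X y *m g y) x *m (P x)^T) 0 0 + ip (g x) (X x) ('D_w' P x).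
    move=> sP; have dp : derivable P x w' by exact: smooth_derivable sP Sx.
    exact: derive_mulmx_tr (dX w') dp.
  have XN0 y : S y -> ip (g y) (X y) (N y) = 0.
    by move=> Sy; rewrite /N ipZr (ipC _ _ (gT Sy)) ip_nX // mulr0.
  have := derive_const_on oS (Z x) Sx XN0; rewrite (dP N (Z x) sN).
  rewrite /h2 (dP Z (N x) sZ) (bracket_N KZ sZ derive_h1Z Sx).
  have := dflat Sx (N x) (Z x); rewrite (_ : det3 _ _ _ = 0); last by rewrite det3E !mxE; ring.
  lra.
- rewrite killing_leibniz // bracket_XX ip0l bracket_XZ // ip0r addr0 //.
- rewrite killing_leibniz // bracketC bracket_XZ // oppr0 ip0l.
  by rewrite /bracket subrr ip0r addr0.
Qed.

(** The rows are [N], [X], [Z]. Row 0 remains anonymous, since later only the commutation relations,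
    the metric in frame components and the derivatives of [h1] and [h2] are needed. The determinant
    is positive because vol (N, X, Z) = <n, N> = |n|. *)
Theorem killing_frame : exists E : 'rV[R]_3 -> 'M[R]_3, smooth_on S E /\
  forall x, S x ->
  [/\ row 1 (E x) = X x /\ row 2 (E x) = Z x, 0 < \det (E x),
    forall a b, 'D_(row a (E x)) (fun y => row b (E y)) x =
                'D_(row b (E x)) (fun y => row a (E y)) x,
    forall v, ip (g x) (v *m E x) (v *m E x) =
      v 0 0 ^+ 2 + h1 x * v 0 1 ^+ 2 + 2 * h2 x * (v 0 1 * v 0 2) + h3 x * v 0 2 ^+ 2 &
    [/\ 0 < h1 x, 0 < gram x,
      forall v, 'D_(v *m E x) h1 x = v 0 0 * (2 * Num.sqrt (gram x)) &
      forall v, 'D_v h2 x = 0]].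
Proof.
pose E x := rows3 (N x) (X x) (Z x); exists E; split.
  move=> k; apply/(C_k_mxP _ _ oS) => i j; have sE (P : 'rV[R]_3 -> 'rV[R]_3) : smooth_on S P -> C_k k S (fun x => P x 0 j).
    by move=> /(smooth_entry oS 0 j).
  case: (ord3P i) => ->.
  - by apply: (C_k_ext oS) (sE N sN) => x _; rewrite rows3E.
  - by apply: (C_k_ext oS) (sE X sX) => x _; rewrite rows3E.
  - by apply: (C_k_ext oS) (sE Z sZ) => x _; rewrite rows3E.
move=> x Sx; have [r0 r1 r2] := row_rows3 (N x) (X x) (Z x).
have rE y : [/\ row 0 (E y) = N y, row 1 (E y) = X y & row 2 (E y) = Z y] by exact: row_rows3.
have f0 : (fun y => row 0 (E y)) = N by apply/funext => y; case: (rE y).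
have f1 : (fun y => row 1 (E y)) = X by apply/funext => y; case: (rE y).
have f2 : (fun y => row 2 (E y)) = Z by apply/funext => y; case: (rE y).
have vE v : v *m E x = v 0 0 *: N x + v 0 1 *: X x + v 0 2 *: Z x.
  by rewrite mulmx_sum_row sum3 r0 r1 r2.
have g0 := gram_gt0 Sx; have sq0 : 0 < Num.sqrt (gram x) by rewrite sqrtr_gt0.
have NX : ip (g x) (N x) (X x) = 0 by rewrite /N ipZl ip_nX // mulr0.
have NZ : ip (g x) (N x) (Z x) = 0 by rewrite /N ipZl ip_nZ // mulr0.
have NN : ip (g x) (N x) (N x) = 1 by rewrite /N ipZl ipZr ip_nn // mulrA rho_sqr.
have XZ : 'D_(X x) Z x = 'D_(Z x) X x.
  by have /eqP := bracket_XZ Sx; rewrite subr_eq0 => /eqP.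
have XN := bracket_N KX sX derive_h1X Sx; have ZN := bracket_N KZ sZ derive_h1Z Sx.
split=> //.
- have : 0 < s x * det3 (N x) (X x) (Z x).
    by rewrite -ip_nE // /N ipZr ip_nn // mulr_gt0 // rho_gt0.
  by rewrite pmulr_rgt0 // s_gt0.
- by move=> a b; case: (ord3P a) => ->; case: (ord3P b) => ->; rewrite ?r0 ?r1 ?r2 ?f0 ?f1 ?f2.
- by move=> v; rewrite vE; exact: ip_unit_orthogonal (gT Sx) NN NX NZ.
split=> //; first exact: h1_gt0.
  move=> v; have dh := smooth_differentiable sh1 Sx.
  rewrite vE (derive_comb3 _ _ _ _ _ _ dh) derive_h1X // derive_h1Z // !mulr0 !addr0; congr (_ * _).
  have -> : 'D_(N x) h1 x = rho x * 'D_(n x) h1 x by rewrite (deriveE _ dh) linearZ /= -(deriveE _ dh).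
  have -> : 'D_(n x) h1 x = 2 * gram x by rewrite -ip_nn // ip_n // mulVKf // pnatr_eq0.
  have E2 : Num.sqrt (gram x) * Num.sqrt (gram x) = gram x by rewrite -expr2 sqr_sqrtr // ltW.
  rewrite /rho -{2}E2 mulrCA; congr (_ * _).
  by rewrite mulKf // gt_eqF.
move=> v; have dh := smooth_differentiable sh2 Sx.
have uE : E x \in unitmx.
  rewrite unitmxE unitfE; apply: contraTneq (gpos Sx (n_neq0 Sx)) => D0.
  have : s x * det3 (N x) (X x) (Z x) = 0 by rewrite /det3 -/(E x) D0 mulr0.
  rewrite -ip_nE // /N ipZr => /eqP; rewrite mulf_eq0 gt_eqF ?rho_gt0 //= => /eqP ->.
  by rewrite ltxx.
rewrite -(mulmxKV uE v) vE (derive_comb3 _ _ _ _ _ _ dh).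
have D w := derive_h2 (w := w) Sx.
by rewrite (D _ (Or31 _ _ erefl)) (D _ (Or32 _ _ erefl)) (D _ (Or33 _ _ erefl)) !mulr0 !addr0.
Qed.

End KillingFrame.

(** * The geometry of M in a chart *)

Lemma chart_imgK (R : realType) (M : topologicalType) (c : chart R M) x :
  chart_img c x -> coord c (param c x) = x.
Proof. by move=> [p cp <-]; rewrite coordK. Qed.

Lemma chart_img_dom (R : realType) (M : topologicalType) (c : chart R M) x :
  chart_img c x -> chart_dom c (param c x).
Proof. by move=> [p cp <-]; rewrite coordK. Qed.

Lemma coord_img (R : realType) (M : topologicalType) (c : chart R M) p :
  chart_dom c p -> chart_img c (coord c p).
Proof. by move=> cp; exists p. Qed.

Lemma det3_mulmx (R : realType) (N : 'M[R]_3) u v w :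
  det3 (u *m N) (v *m N) (w *m N) = det3 u v w * \det N.
Proof.
rewrite /det3 -det_mulmx; congr (\det _); apply/matrixP => i j; rewrite [RHS]mxE.
by case: (ord3P i) => ->; rewrite !rows3E mxE; apply: eq_bigr => k _; rewrite rows3E.
Qed.

(** [D i] stands for the i-th partial derivative of the metric; the left side is twice the
    contracted Christoffel symbol of the first kind. *)
Lemma koszul_contract (R : realType) (D : 'I_3 -> 'M[R]_3) (u v w : 'rV[R]_3) :
  ((\sum_i \sum_j (u 0 i * w 0 j) *:
     (\row_l (D i j l + D j i l - D l i j) : 'rV[R]_3)) *m v^T) 0 0 =
  ip (\sum_i u 0 i *: D i) w v + ip (\sum_i w 0 i *: D i) u v
  - ip (\sum_i v 0 i *: D i) u w.
Proof. rewrite /ip !sum3 !mxE !sum3 !mxE !sum3 !mxE; ring. Qed.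

Lemma ext_deriv_contract (R : realType) (D : 'I_3 -> 'rV[R]_3) (b : 'M[R]_3) (u v : 'rV[R]_3) :
  (forall j k, b j k = D j 0 k - D k 0 j) ->
  ((\sum_i u 0 i *: D i) *m v^T) 0 0 - ((\sum_i v 0 i *: D i) *m u^T) 0 0 =
  (u *m b *m v^T) 0 0.
Proof. by move=> bE; rewrite !sum3 !mxE !sum3 !mxE !sum3 !bE; ring. Qed.

(** When the Koszul formulas for [(u, v)] and [(v, u)] are added, the derivatives of the metric
    along [u] and [v] cancel and those along the field add up. *)
Lemma killing_sum (R : realType) (a b b' du du' dv dv' dX dX' : R) :
  dX' = dX -> dv' = dv -> du' = du -> b' = b ->
  a + 2^-1 * (du + dX - dv') + (b + 2^-1 * (dv + dX' - du')) = 0 -> dX + a + b' = 0.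
Proof. by move=> -> -> -> ->; lra. Qed.

(** The axial vector of an antisymmetric matrix. Addition in ['I_3] is modulo 3, so the indices run
    cyclically. *)
Definition antisym_axis (R : realType) (P : 'M[R]_3) : 'rV[R]_3 :=
  \row_i P (i + 1) (i + 2).

Lemma antisymE (R : realType) (P : 'M[R]_3) : P^T = - P ->
  [/\ P 0 0 = 0, P 1 1 = 0 & P 2 2 = 0] /\
  [/\ P 1 0 = - P 0 1, P 2 1 = - P 1 2 & P 0 2 = - P 2 0].
Proof.
move=> PT; have PN j k : P k j = - P j k.
  by have /matrixP /(_ j k) := PT; rewrite [LHS]mxE [RHS]mxE.
have P0 j : P j j = 0.
  by apply/eqP; rewrite -[_ == 0](mulrn_eq0 _ 2) /= mulr2n {1}PN addNr.
by split; split.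
Qed.

Lemma antisym_axisE (R : realType) (P : 'M[R]_3) :
  [/\ antisym_axis P 0 0 = P 1 2, antisym_axis P 0 1 = P 2 0 & antisym_axis P 0 2 = P 0 1].
Proof. by split; rewrite mxE; congr (P _ _); exact: val_inj. Qed.

Lemma antisym_contract (R : realType) (P : 'M[R]_3) a a' : P^T = - P ->
  (a *m P *m a'^T) 0 0 = det3 (antisym_axis P) a a'.
Proof.
move=> /antisymE[[p00 p11 p22] [p10 p21 p02]]; have [q0 q1 q2] := antisym_axisE P.
by rewrite det3E q0 q1 q2 !mxE !sum3 !mxE !sum3 p00 p11 p22 p10 p21 p02; ring.
Qed.

(** Each pair of indices occurs twice in the double sum, with equal contributions; the factor [2^-1]
    undoes this. *)
Lemma antisym_star (R : realType) (P : 'M[R]_3) r i : P^T = - P ->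
  2^-1 * (\sum_(j < 3) \sum_(k < 3) P j k *
    (r * det3 (delta_mx 0 j) (delta_mx 0 k) (delta_mx 0 i))) = (r *: antisym_axis P) 0 i.
Proof.
move=> /antisymE[[p00 p11 p22] [p10 p21 p02]]; have [q0 q1 q2] := antisym_axisE P.
move: (antisym_axis P) q0 q1 q2 => q q0 q1 q2.
rewrite [RHS]mxE !sum3 !det3E !mxE p00 p11 p22 p10 p21 p02.
have neq : ((0 == 1 :> 'I_3) = false) * ((1 == 0 :> 'I_3) = false) *
  ((0 == 2 :> 'I_3) = false) * ((2 == 0 :> 'I_3) = false) *
  ((1 == 2 :> 'I_3) = false) * ((2 == 1 :> 'I_3) = false) by [].
by case: (ord3P i) => ->; rewrite ?q0 ?q1 ?q2 !eqxx !neq /=; field.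
Qed.

Lemma det3Z (R : realType) r (a b d : 'rV[R]_3) : det3 (r *: a) b d = r * det3 a b d.
Proof. by rewrite !det3E !mxE; ring. Qed.

Section InChart.
Variables (R : realType) (M : oriented_3manifold R) (g : tensor2_comp M) (c : chart R M).
Hypotheses (hg : riemannian_metric g) (ac : atlas c).
Let S := chart_img c.
Let gc x := g c (param c x).

Let oS : open S. Proof. exact: chart_img_open. Qed.
Let sg : smooth_on S gc. Proof. by case: hg => _ /(_ c ac). Qed.
Lemma metric_sym x : S x -> (gc x)^T = gc x.
Proof. by case: hg => _ _ h _ Sx; apply: h => //; exact: chart_img_dom. Qed.
Lemma metric_pos x : S x -> forall v, v != 0 -> 0 < ip (gc x) v v.
Proof. by case: hg => _ _ _ h Sx; apply: h => //; exact: chart_img_dom. Qed.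
Let ug x : S x -> gc x \in unitmx.
Proof. by move=> Sx; exact/posdef_unit/metric_pos. Qed.

(** Koszul's formula on constant [u], [v]: pairing with the metric cancels the inverse metric inside
    the Christoffel symbols. *)
Lemma ip_nabla (X : vfield_comp M) x u v : smooth_on S (X c \o param c) -> S x ->
  ip (gc x) (nabla g X c (param c x) u) v =
  ip (gc x) ('D_u (X c \o param c) x) v +
  2^-1 * (ip ('D_u gc x) (X c (param c x)) v + ip ('D_(X c (param c x)) gc x) u v
          - ip ('D_v gc x) u (X c (param c x))).
Proof.
move=> sX Sx; have xK := chart_imgK Sx.
set p := param c x; set Xp := X c p.
have dg : differentiable gc x by exact: smooth_differentiable sg Sx.
have dX : differentiable (X c \o param c) x by exact: smooth_differentiable sX Sx.
have pg i j l : pderiv c i (fun q => g c q j l) p = ('D_(delta_mx 0 i) gc x) j l.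
  by rewrite /pderiv xK -derive_entry //; exact: diff_derivable.
have pX i k : pderiv c i (fun q => X c q 0 k) p = ('D_(delta_mx 0 i) (X c \o param c) x) 0 k.
  by rewrite /pderiv xK -derive_entry //; exact: diff_derivable.
(* Twice the Christoffel symbols of the first kind, with the lowered index as column. *)
pose a i j : 'rV[R]_3 := \row_l (('D_(delta_mx 0 i) gc x) j l + ('D_(delta_mx 0 j) gc x) i l
  - ('D_(delta_mx 0 l) gc x) i j).
have gi : (invmx (gc x))^T = invmx (gc x) by rewrite trmx_inv metric_sym.
have chr i j : (\row_k christoffel g c p k i j) *m gc x = 2^-1 *: a i j.
  have -> : (\row_k christoffel g c p k i j) = 2^-1 *: (a i j *m invmx (gc x)).
    apply/rowP => k; rewrite !mxE /christoffel; congr (_ * _); apply: eq_bigr => l _.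
    rewrite !pg mxE mulrC; congr (_ * _).
    by rewrite -[LHS]/(invmx (gc x) k l) -{1}gi mxE.
  by rewrite -scalemxAl mulmxKV ?ug.
have -> : nabla g X c p u = \sum_i u 0 i *: ('D_(delta_mx 0 i) (X c \o param c) x +
    \sum_j Xp 0 j *: (\row_k christoffel g c p k i j)).
  apply/rowP => k; rewrite mxE summxE; apply: eq_bigr => i _.
  rewrite !mxE pX summxE; congr (_ * (_ + _)); apply: eq_bigr => j _.
  by rewrite !mxE mulrC.
have E : (\sum_i u 0 i *: ('D_(delta_mx 0 i) (X c \o param c) x +
    \sum_j Xp 0 j *: (\row_k christoffel g c p k i j))) *m gc x =
  'D_u (X c \o param c) x *m gc x + 2^-1 *: \sum_i \sum_j (u 0 i * Xp 0 j) *: a i j.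
  rewrite mulmx_suml scaler_sumr.
  rewrite (derive_sum_coord u dX) mulmx_suml -big_split /=; apply: eq_bigr => i _.
  rewrite -!scalemxAl mulmxDl scalerDr; congr (_ + _).
  rewrite mulmx_suml !scaler_sumr; apply: eq_bigr => j _.
  by rewrite -scalemxAl chr !scalerA; congr (_ *: _); ring.
rewrite {1}/ip E mulmxDl mxE -/(ip _ _ _) -scalemxAl mxE; congr (_ + _ * _).
rewrite (derive_sum_coord u dg) (derive_sum_coord v dg) (derive_sum_coord Xp dg).
exact: (koszul_contract (fun i => 'D_(delta_mx 0 i) gc x)).
Qed.

(** Symmetrising [ip_nabla] in [u] and [v] removes the connection; this uses that the derivatives of
    the metric are symmetric matrices too. *)
Lemma killing_lie (X : vfield_comp M) : killing g X -> lie_killing S gc (X c \o param c).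
Proof.
move=> [[_ sXc] KX] x Sx u v; have sX := sXc c ac; have cp := chart_img_dom Sx.
have gxT := metric_sym Sx.
have DT w : ('D_w gc x)^T = 'D_w gc x.
  have dg : derivable gc x w by exact: smooth_derivable sg Sx.
  rewrite -(derive_tr dg); apply: (near_derive oS) => // y Sy; exact: metric_sym.
have : ip (gc x) (nabla g X c (param c x) u) v + ip (gc x) u (nabla g X c (param c x) v) = 0.
  exact: KX.
rewrite (ip_nabla u v sX Sx) (ipC u _ gxT) (ip_nabla v u sX Sx).
set Xp := X c (param c x) => K.
have e1 : ip ('D_Xp gc x) v u = ip ('D_Xp gc x) u v by exact: ipC (DT Xp).
have e2 : ip ('D_v gc x) u Xp = ip ('D_v gc x) Xp u by exact: ipC (DT v).
have e3 : ip ('D_u gc x) v Xp = ip ('D_u gc x) Xp v by exact: ipC (DT u).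
have e4 : ip (gc x) u ('D_v (X c \o param c) x) = ip (gc x) ('D_v (X c \o param c) x) u.
  exact: ipC gxT.
exact: killing_sum e1 e2 e3 e4 K.
Qed.

(** In invariant terms, d X^flat is the contraction of the volume form with the curl. Raising both
    indices of the two-form [b] gives an antisymmetric [P] with axis q. Then b (u, v) = det (q, u G,
    v G) = det (q G^-1, u, v) det G, and the curl is q G^-1 times the square root of det G. *)
Lemma curl_flat (X : vfield_comp M) x u v : smooth_on S (X c \o param c) -> S x ->
  ('D_u (fun y => X c (param c y) *m gc y) x *m v^T) 0 0
  - ('D_v (fun y => X c (param c y) *m gc y) x *m u^T) 0 0 =
  Num.sqrt (\det (gc x)) * det3 (curl g X c (param c x)) u v.
Proof.
move=> sX Sx; have xK := chart_imgK Sx; have gxT := metric_sym Sx.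
set p := param c x; set G := gc x; set xi := fun y => _.
have sxi : smooth_on S xi by exact: smooth_mulmx.
have dxi : differentiable xi x by exact: smooth_differentiable sxi Sx.
pose b := ext_deriv (flat g X) c p.
have bE j k : b j k = ('D_(delta_mx 0 j) xi x) 0 k - ('D_(delta_mx 0 k) xi x) 0 j.
  rewrite /b /ext_deriv mxE /pderiv xK.
  by rewrite -!derive_entry //; exact: diff_derivable.
have -> : ('D_u xi x *m v^T) 0 0 - ('D_v xi x *m u^T) 0 0 = (u *m b *m v^T) 0 0.
  rewrite (derive_sum_coord u dxi) (derive_sum_coord v dxi).
  exact: (ext_deriv_contract (D := fun i => 'D_(delta_mx 0 i) xi x) u v bE).
have bT : b^T = - b.
  by apply/matrixP => j k; rewrite [LHS]mxE [RHS]mxE !bE opprB.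
have uG : G \in unitmx := ug Sx.
have detG0 : 0 < \det G by apply: posdef_det_gt0 => //; exact: metric_pos.
pose sD := Num.sqrt (\det G).
have sD2 : sD * sD = \det G by rewrite -expr2 sqr_sqrtr // ltW.
pose P := invmx G *m b *m (invmx G)^T.
have PT : P^T = - P.
  by rewrite /P !trmx_mul trmxK bT mulNmx mulmxN mulmxA.
have bP : (u *m b *m v^T) 0 0 = ((u *m G) *m P *m (v *m G)^T) 0 0.
  by rewrite /P trmx_mul gxT trmx_inv gxT !mulmxA mulmxK // mulmxKV.
have star : curl g X c p = sD *: (antisym_axis P *m invmx G).
  rewrite /curl /sharp -/G scalemxAl; congr (_ *m _).
  apply/rowP => i; rewrite mxE -/G -/b -/P -(antisym_star sD i PT).
  by congr (_ * _).
rewrite bP star (antisym_contract _ _ PT) -{1}(mulmxKV uG (antisym_axis P)) det3_mulmx.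
by rewrite -/sD -sD2 det3Z mulrC mulrA.
Qed.

End InChart.

(** * Functions of the first coordinate on a cube *)

Section Profile.
(** In the application [H1], [H2] and [k] are |X|^2, <X, Z> and |n| in the new coordinates. In the
    maximum norm the ball is a cube. *)
Variables (R : realType) (y0 : 'rV[R]_3) (d : R) (H1 H2 k : 'rV[R]_3 -> R).
Hypotheses (d0 : 0 < d) (sH1 : smooth_on (ball y0 d) H1).
Hypothesis H1_gt0 : forall y, ball y0 d y -> 0 < H1 y.
Hypothesis DH1 : forall y v, ball y0 d y -> 'D_v H1 y = v 0 0 * (2 * k y).
Hypothesis dH2 : forall y v, ball y0 d y -> derivable H2 y v.
Hypothesis DH2 : forall y v, ball y0 d y -> 'D_v H2 y = 0.

Let e0 : 'rV[R]_3 := delta_mx 0 0.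
Let ob : open (ball y0 d). Proof. exact: ball_open. Qed.

Lemma ball_segment (z y : 'rV[R]_3) (t : R) : ball y0 d z -> ball y0 d y -> 0 <= t <= 1 ->
  ball y0 d (z + t *: (y - z)).
Proof.
rewrite -!ball_normE /= => zd yd /andP[t0 t1].
rewrite (_ : y0 - _ = (1 - t) *: (y0 - z) + t *: (y0 - y)); last first.
  by apply/rowP => i; rewrite !mxE; ring.
rewrite (le_lt_trans (ler_normD _ _)) // !normrZ !ger0_norm ?subr_ge0 //.
(* Strictness comes from [z] at [t = 0] and from [y] otherwise. *)
have [->|tn0] := eqVneq t 0; first by rewrite subr0 mul1r mul0r addr0.
rewrite (@lt_le_trans _ _ ((1 - t) * d + t * d)) //; last by rewrite -mulrDl subrK mul1r.
by rewrite ler_ltD // ?ler_wpM2l ?subr_ge0 // ?(ltW zd) // ltr_pM2l // lt_def tn0.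
Qed.

(** By convexity of the ball, a derivative vanishing in the single direction [y - z] is enough. *)
Lemma eq_of_derive0 (H : 'rV[R]_3 -> R) y z : ball y0 d y -> ball y0 d z ->
  (forall x v, ball y0 d x -> derivable H x v) ->
  (forall x, ball y0 d x -> 'D_(y - z) H x = 0) -> H y = H z.
Proof.
move=> yd zd dH DH; have [t t01|t t01] := @MVT_line _ _ H z (y - z).
  exact/dH/ball_segment.
rewrite [z + (y - z)]addrC subrK (DH _ (ball_segment zd yd t01)).
exact: subr0_eq.
Qed.

Lemma H2_const y : ball y0 d y -> H2 y = H2 y0.
Proof. by move=> yd; apply: eq_of_derive0 => // [|x xd]; [exact: ballxx|exact: DH2]. Qed.

Lemma H1_first_coord y z : ball y0 d y -> ball y0 d z -> y 0 0 = z 0 0 -> H1 y = H1 z.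
Proof.
move=> yd zd yz; apply: eq_of_derive0 => // [x v xd|x xd].
  exact: smooth_derivable sH1 xd.
by rewrite DH1 // !mxE yz subrr mul0r.
Qed.

(** The axis through the centre, parametrised by the first coordinate itself, so that [phi] is a
    function of r. *)
Let line (t : R) : 'rV[R]_3 := y0 + (t - y0 0 0) *: e0.
Let phi (t : R) : R := Num.sqrt (H1 (line t)).

Let e0E : e0 0 0 = 1. Proof. by rewrite mxE. Qed.

Let norm_e0 : `|e0| <= 1.
Proof.
apply: mx_norm_le => // i j; rewrite mxE.
by case: (_ && _); rewrite ?normr1 ?normr0.
Qed.

Let line_coord t : line t 0 0 = t.
Proof. by rewrite !mxE !eqxx /= mulr1 addrCA subrr addr0. Qed.

Let line_ball (t : R) : ball (y0 0 0) d t -> ball y0 d (line t).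
Proof.
rewrite -!ball_normE /= /line opprD addNKr normrN normrZ distrC => td.
by rewrite (le_lt_trans _ td) // ler_piMr.
Qed.

Let smooth_phi : smooth_on (ball (y0 0 0) d : set R^o) (phi : R^o -> R^o).
Proof.
have oI : open (ball (y0 0 0) d : set R^o) by exact: ball_open.
have sl : smooth_on (ball (y0 0 0) d : set R^o) (line : R^o -> 'rV[R]_3).
  have dl (t : R^o) : is_derive t (1 : R^o) (line : R^o -> 'rV[R]_3) e0.
    rewrite (_ : line = fun s : R => (y0 - y0 0 0 *: e0) + s *: e0).
      exact: is_derive_affine.
    by apply/funext => s; rewrite /line scalerBl addrAC addrA.
  have dl' t : differentiable (line : R^o -> 'rV[R]_3) t.
    by apply/derivable1_diffP; case: (dl t).
  move=> [|m]; first by move=> t _; exact: differentiable_continuous.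
  split=> // v; apply: (C_k_ext oI) (C_k_cst m _ (v *: e0)) => t _.
  rewrite deriveE // -[v in RHS]mulr1 -[v * 1]/(v *: (1 : R^o)) linearZ /= -deriveE //.
  by rewrite (derive_val (is_derive := dl t)) .
move=> m; apply: (C_k_sqrt oI) => [t /line_ball/H1_gt0//|].
exact: (C_k_comp oI ob line_ball (sl m) (sH1 m)).
Qed.

Let phi_gt0 t : ball (y0 0 0) d t -> 0 < phi t.
Proof. by move=> td; rewrite sqrtr_gt0; exact/H1_gt0/line_ball. Qed.

Let coord_ball y : ball y0 d y -> ball (y0 0 0) d (y 0 0).
Proof.
rewrite -!ball_normE /= => yd; apply: le_lt_trans yd.
by have := ler_mx_entry (y0 - y) 0 0; rewrite !mxE.
Qed.

Let phi_sqr y : ball y0 d y -> phi (y 0 0) * phi (y 0 0) = H1 y.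
Proof.
move=> yd; have lb := line_ball (coord_ball yd).
rewrite /phi -expr2 sqr_sqrtr; last exact/ltW/H1_gt0.
by apply: H1_first_coord => //; exact: line_coord.
Qed.

(** The square of [phi] is differentiated along the parallel to the first axis through [y] rather
    than through [y0], so that [k] is obtained at [y]. *)
Let phi_derive y : ball y0 d y -> phi (y 0 0) * (phi^`())%classic (y 0 0) = k y.
Proof.
move=> yd; have rd := coord_ball yd; set r := y 0 0 in rd *.
have oI : open (ball (y0 0 0) d : set R^o) by exact: ball_open.
have dphi : derivable (phi : R^o -> R^o) r 1.
  by apply: diff_derivable; case: (smooth_phi 1%N) => + _; exact.
have E : \forall t \near r, phi t * phi t = H1 ((y - r *: e0) + t *: e0).
  have cl : {for r, continuous (fun t : R => (y - r *: e0) + t *: e0)}.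
    by apply/differentiable_continuous/derivable1_diffP; case: (is_derive_affine (y - r *: e0) e0 r).
  have n1 : nbhs r (fun t : R => ball y0 d ((y - r *: e0) + t *: e0)).
    by apply: cl; rewrite subrK; exact: open_nbhs_nbhs.
  apply: filterS n1 => t td; rewrite -(phi_sqr td); congr (phi _ * phi _).
    by rewrite !mxE !eqxx /= !mulr1 subrr add0r.
  by rewrite !mxE !eqxx /= !mulr1 subrr add0r.
have dl : is_derive r (1 : R) (fun t : R => H1 ((y - r *: e0) + t *: e0)) (2 * k y).
  have := @is_derive_line _ _ _ H1 (y - r *: e0) e0 r.
  rewrite subrK DH1 // e0E mul1r; apply.
  exact: smooth_derivable sH1 yd.
have := near_eq_derive (1 : R) E; rewrite (derive_val (is_derive := dl)).
rewrite (derive_mul dphi dphi) derive1E.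
have half (a b m : R) : a * b + b * a = 2 * m -> b * a = m by lra.
exact: half.
Qed.

Theorem radial_profile : exists (c : R) (f : R -> R),
  [/\ smooth_on (ball (y0 0 0) d : set R^o) (f : R^o -> R^o),
      forall t, ball (y0 0 0) d t -> 0 < f t &
      forall y, ball y0 d y -> [/\ f (y 0 0) * f (y 0 0) = H1 y, H2 y = c &
        f (y 0 0) * (f^`())%classic (y 0 0) = k y]].
Proof.
exists (H2 y0), phi; split=> // y yd.
by split; [exact: phi_sqr|exact: H2_const|exact: phi_derive].
Qed.

End Profile.

(** * Straightening a chart *)

Section Charts.
Variables (R : realType) (M : topologicalType).
Implicit Types c : chart R M.

Lemma coord_continuous_at c p : chart_dom c p -> {for p, continuous (coord c)}.
Proof.
move=> cp; have := @coord_continuous _ _ c.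
rewrite continuous_open_subspace; last exact: chart_dom_open.
by apply; rewrite inE.
Qed.

Lemma param_continuous_at c x : chart_img c x -> {for x, continuous (param c)}.
Proof.
move=> cx; have := @param_continuous _ _ c.
rewrite continuous_open_subspace; last exact: chart_img_open.
by apply; rewrite inE.
Qed.

Lemma coord_imageE c (O : set M) :
  coord c @` (chart_dom c `&` O) = chart_img c `&` param c @^-1` O.
Proof.
apply/seteqP; split=> [x [p [cp Op] <-]|x [cx Ox]].
  by split; [exact: coord_img|rewrite /= coordK].
by exists (param c x); [split=> //; exact: chart_img_dom|exact: chart_imgK].
Qed.

Lemma open_coord_image c (O : set M) : open O -> open (coord c @` (chart_dom c `&` O)).
Proof.
move=> oO; rewrite coord_imageE openE => x [cx Ox].
have n1 : nbhs x (chart_img c) by apply: open_nbhs_nbhs; split=> //; exact: chart_img_open.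
have n2 : nbhs x (param c @^-1` O).
  by apply: (param_continuous_at cx); exact: open_nbhs_nbhs.
by rewrite /interior; exact: filterI.
Qed.

Lemma jacobianP n m (f : 'rV[R]_n -> 'rV[R]_m) x (N : 'M[R]_(n, m)) :
  differentiable f x -> (forall v, 'D_v f x = v *m N) -> jacobian f x = N.
Proof.
move=> df DN; apply/row_matrixP => i; rewrite !rowE -DN.
by rewrite -deriveEjacobian.
Qed.

Lemma jacobian_comp n m p (f : 'rV[R]_n -> 'rV[R]_m) (h : 'rV[R]_m -> 'rV[R]_p) x :
  differentiable f x -> differentiable h (f x) ->
  jacobian (h \o f) x = jacobian f x *m jacobian h (f x).
Proof.
move=> df dh; apply: jacobianP; first exact: differentiable_comp.
move=> v; rewrite deriveE; last exact: differentiable_comp.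
by rewrite diff_comp // /= mulmxA !mul_rV_lin1.
Qed.

Lemma smooth_comp n m (A : set 'rV[R]_n.+1) (B : set 'rV[R]_m.+1)
   (f : 'rV[R]_n.+1 -> 'rV[R]_m.+1) p q (h : 'rV[R]_m.+1 -> 'M[R]_(p, q)) k :
  open A -> open B -> (forall x, A x -> B (f x)) -> C_k k A f -> C_k k B h ->
  C_k k A (h \o f).
Proof.
move=> oA oB fAB cf ch; apply/(C_k_mxP _ _ oA) => i j.
have /(C_k_mxP _ _ oB) /(_ i j) chij := ch.
exact: (C_k_comp oA oB fAB cf chij).
Qed.

(* The derivative [E \o G] of [G] inherits the regularity of [G]. *)
Lemma smooth_inverse n (A O : set 'rV[R]_n.+1) (G : 'rV[R]_n.+1 -> 'rV[R]_n.+1)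
   (E : 'rV[R]_n.+1 -> 'M[R]_n.+1) :
  open A -> open O -> smooth_on O E -> (forall y, A y -> O (G y)) ->
  (forall y, A y -> differentiable G y) -> (forall y v, A y -> 'D_v G y = v *m E (G y)) ->
  smooth_on A G.
Proof.
move=> oA oO sE GAO dG DG; elim=> [|k IH]; first by move=> y /dG; exact: differentiable_continuous.
split=> // v; apply: (C_k_ext oA) (_ : C_k k A (fun y => v *m (E \o G) y)).
  by move=> y Ay; rewrite DG.
by apply: (C_k_mulmx oA (C_k_cst _ _ _)); exact: (smooth_comp oA oO GAO IH (sE k)).
Qed.

End Charts.

(** * Reparametrising a chart of the oriented atlas by a local diffeomorphism *)

Section NewChart.
Variables (R : realType) (M : oriented_3manifold R) (c : chart R M).
Variables (W O : set 'rV[R]_3) (F G : 'rV[R]_3 -> 'rV[R]_3) (E : 'rV[R]_3 -> 'M[R]_3).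
Hypotheses (ac : atlas c) (oW : open W) (oO : open O) (Wc : W `<=` chart_img c).
Hypothesis FG : forall x, W x -> O (F x) /\ G (F x) = x.
Hypothesis GF : forall y, O y -> W (G y) /\ F (G y) = y.
Hypotheses (sF : smooth_on W F) (sG : smooth_on O G).
Hypothesis detE : forall x, W x -> 0 < \det (E x).
Hypothesis DF : forall x v, W x -> 'D_v F x = v *m invmx (E x).
Hypothesis DG : forall y v, O y -> 'D_v G y = v *m E (G y).

Let dom := chart_dom c `&` coord c @^-1` W.

Let img : (F \o coord c) @` dom = O.
Proof.
apply/seteqP; split=> [y [p [cp Wp] <-]|y Oy]; first by case: (FG Wp).
have [WG FGy] := GF Oy; have cG := Wc WG.
exists (param c (G y)); last by rewrite /= chart_imgK.
by split; [exact: chart_img_dom|rewrite /= chart_imgK].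
Qed.

Let dom_open : open dom.
Proof.
rewrite openE => p [cp Wp]; rewrite /interior; apply: filterI.
  by apply: open_nbhs_nbhs; split=> //; exact: chart_dom_open.
by apply: (coord_continuous_at cp); exact: open_nbhs_nbhs.
Qed.

Let img_open : open ((F \o coord c) @` dom). Proof. by rewrite img. Qed.

Let coordK' p : dom p -> (param c \o G) ((F \o coord c) p) = p.
Proof. by move=> [cp Wp] /=; case: (FG Wp) => _ ->; rewrite coordK. Qed.

Let coord_cont : {within dom, continuous (F \o coord c)}.
Proof.
rewrite continuous_open_subspace // => p; rewrite inE => -[cp Wp].
apply: continuous_comp; first exact: coord_continuous_at.
exact: (sF 0%N).
Qed.

Let param_cont : {within (F \o coord c) @` dom, continuous (param c \o G)}.
Proof.
rewrite continuous_open_subspace // img => y; rewrite inE => Oy.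
apply: continuous_comp; first exact: (sG 0%N).
by apply: param_continuous_at; apply: Wc; case: (GF Oy).
Qed.

Definition new_chart : chart R M :=
  @Chart R M dom (F \o coord c) (param c \o G) dom_open img_open coordK' coord_cont param_cont.

Lemma new_chart_img : chart_img new_chart = O. Proof. exact: img. Qed.

Let jacF x : W x -> jacobian F x = invmx (E x).
Proof. by move=> Wx; apply: jacobianP; [exact: smooth_differentiable sF Wx|move=> v; exact: DF]. Qed.

Let jacG y : O y -> jacobian G y = E (G y).
Proof. by move=> Oy; apply: jacobianP; [exact: smooth_differentiable sG Oy|move=> v; exact: DG]. Qed.

(** The transition is that of [c] precomposed with [G], so the Jacobian gains the factor [E], of
    positive determinant. *)
Lemma new_chart_from c' : atlas c' -> oriented_compatible new_chart c'.
Proof.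
move=> ac'; have [st dt] := atlas_compatible ac ac'.
have oA : open (coord new_chart @` (chart_dom new_chart `&` chart_dom c')).
  by apply: open_coord_image; exact: chart_dom_open.
have oB : open (coord c @` (chart_dom c `&` chart_dom c')).
  by apply: open_coord_image; exact: chart_dom_open.
have AO y : (coord new_chart @` (chart_dom new_chart `&` chart_dom c')) y -> O y.
  by move=> [q [[cq Wq] _] <-]; case: (FG Wq).
have AB y : (coord new_chart @` (chart_dom new_chart `&` chart_dom c')) y ->
   (coord c @` (chart_dom c `&` chart_dom c')) (G y).
  move=> [q [[cq Wq] c'q] <-]; exists q => //=.
  by case: (FG Wq) => _ ->.
split=> [k|q [cq Wq] c'q].
  exact: (smooth_comp oA oB AB (C_k_sub AO (sG k)) (st k)).
have [Oq GFq] := FG Wq.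
have dG : differentiable G (F (coord c q)) by exact: smooth_differentiable sG Oq.
have dT : differentiable (transition c c') (G (F (coord c q))).
  by rewrite GFq; apply: (smooth_differentiable st); exists q.
rewrite /jac -[transition _ _]/(transition c c' \o G) /=.
by rewrite jacobian_comp // det_mulmx mulr_gt0 // ?jacG ?GFq ?detE // dt.
Qed.

(** Here [F] is composed after the transition into [c]; the additional factor is the inverse of
    [E]. *)
Lemma new_chart_to c' : atlas c' -> oriented_compatible c' new_chart.
Proof.
move=> ac'; have [st dt] := atlas_compatible ac' ac.
pose A := coord c' @` (chart_dom c' `&` chart_dom new_chart).
have oA : open A by apply: open_coord_image; exact: chart_dom_open.
have AA : A `<=` coord c' @` (chart_dom c' `&` chart_dom c).
  by move=> x [q [c'q [cq _]] <-]; exists q.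
have AW x : A x -> W (transition c' c x).
  by move=> [q [c'q [cq Wq]] <-]; rewrite /transition /= coordK.
split=> [k|q c'q [cq Wq]].
  exact: (smooth_comp oA oW AW (C_k_sub AA (st k)) (sF k)).
have E1 : transition c' c (coord c' q) = coord c q by rewrite /transition /= coordK.
have dT : differentiable (transition c' c) (coord c' q).
  by apply: (smooth_differentiable st); exists q.
have dF : differentiable F (transition c' c (coord c' q)).
  by rewrite E1; exact: smooth_differentiable sF Wq.
rewrite /jac -[transition _ _]/(F \o transition c' c).
rewrite jacobian_comp // det_mulmx mulr_gt0 //; first exact: dt.
by rewrite E1 jacF // det_inv invr_gt0 detE.
Qed.

Lemma new_chart_atlas : atlas new_chart.
Proof. by apply: atlas_maximal => c' ac'; split; [exact: new_chart_from|exact: new_chart_to]. Qed.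

Lemma new_chart_jac q : chart_dom new_chart q -> jac c new_chart q = invmx (E (coord c q)).
Proof.
move=> [cq Wq]; have dF : differentiable F (coord c q) by exact: smooth_differentiable sF Wq.
(* Outside [chart_img c] the transition involves arbitrary values, so it agrees with [F] only near
   the point. *)
have nE : \forall x \near coord c q, F x = transition c new_chart x.
  have : nbhs (coord c q) W by exact: open_nbhs_nbhs.
  by apply: filterS => x Wx; rewrite /transition /= chart_imgK //; exact: Wc.
apply: jacobianP; first exact: near_eq_differentiable nE dF.
by move=> v; rewrite -(near_eq_derive v nE) DF.
Qed.

End NewChart.

(** * Assembly: adapted coordinates around a point of U *)

Lemma lie_killing_scale (R : realType) (S : set 'rV[R]_3) g a Y :
  smooth_on S g -> smooth_on S Y -> lie_killing S g Y ->
  lie_killing S g (fun x => a *: Y x).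
Proof.
move=> sg sY KY x Sx u v; have dg := smooth_differentiable sg Sx.
have dY w : 'D_w (fun x => a *: Y x) x = a *: 'D_w Y x.
  by rewrite deriveZ //; exact: smooth_derivable sY Sx.
have -> : 'D_(a *: Y x) g x = a *: 'D_(Y x) g x by rewrite !(deriveE _ dg) linearZ.
rewrite !dY ipZl ipZr.
have -> : ip (a *: 'D_(Y x) g x) u v = a * ip ('D_(Y x) g x) u v.
  by rewrite /ip -scalemxAr -scalemxAl mxE.
by rewrite -!mulrDr KY // mulr0.
Qed.

Lemma free_pair (R : realType) (u v : 'rV[R]_3) a b :
  free [:: u; v] -> a *: u + b *: v = 0 -> a = 0 /\ b = 0.
Proof.
rewrite free_cons span_seq1 => /andP[uv fv] E.
have v0 : v != 0 by rewrite -seq1_free.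
have [a0|an0] := eqVneq a 0.
  split=> //; move: E; rewrite a0 scale0r add0r => /eqP.
  by rewrite scaler_eq0 (negbTE v0) orbF => /eqP.
case/negP: uv; have -> : u = (- (a^-1 * b)) *: v.
  apply: (scalerI an0); rewrite scalerA mulrN mulrA divff // mul1r scaleNr.
  by apply/eqP; rewrite -addr_eq0 E.
by rewrite memvZ // memv_line.
Qed.

Theorem theorem4p9 (R : realType) (M : oriented_3manifold R)
    (g : tensor2_comp M) (X : vfield_comp M) (U : set M)
    (hg : riemannian_metric g)
    (hX : killing g X)
    (hcurl : killing g (curl g X))
    (hU : open U)
    (hfree : forall c p, atlas c -> chart_dom c p -> U p ->
       free [:: X c p; curl g X c p]) :
  forall p, U p ->
  exists psi : chart R M,
    [/\ atlas psi, chart_dom psi p, chart_dom psi `<=` U &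
      exists (c : R) (phi : R -> R),
        let rrange := [set y 0 0 | y in chart_img psi] in
        [/\ smooth_on (rrange : set R^o) (phi : R^o -> R^o),
            forall r, rrange r -> 0 < phi r &
            forall q, chart_dom psi q ->
              let r := coord psi q 0 0 in
              [/\ forall v : 'rV[R]_3,
                    let dr := v 0 0 in
                    let dtheta := v 0 1 in
                    let dz := v 0 (2 : 'I_3) in
                    inner g psi q v v =
                      dr ^+ 2 + (phi r * dtheta + c / phi r * dz) ^+ 2
                      + ((phi^`())%classic r) ^+ 2 * dz ^+ 2,
                  X psi q = basis_vec R 1 &
                  curl g X psi q = 2 *: basis_vec R (2 : 'I_3)]]].
Proof.
move=> p Up; have [c ac cp] := atlas_cover p.
pose S := coord c @` (chart_dom c `&` U).
have oS : open S by exact: open_coord_image.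
have SE : S = chart_img c `&` param c @^-1` U by exact: coord_imageE.
have Sc : S `<=` chart_img c by rewrite SE => x [].
have SU x : S x -> U (param c x) by rewrite SE => -[].
have Sp : S (coord c p) by exists p.
pose gc x := g c (param c x).
(* The half makes [dflat] hold with [2 *: Zc] and later turns the curl into twice the third
   coordinate field; [lie_killing_scale] keeps [Zc] Killing. *)
pose Xc := X c \o param c; pose Zc x := 2^-1 *: (curl g X c \o param c) x.
have [gtrans gsmooth _ _] := hg; have [[Xtrans Xsmooth] _] := hX.
have [[Wtrans Wsmooth] _] := hcurl.
have sgS : smooth_on S gc by move=> k; exact: C_k_sub Sc (gsmooth c ac k).
have sX : smooth_on S Xc by move=> k; exact: C_k_sub Sc (Xsmooth c ac k).
have sW : smooth_on S (curl g X c \o param c) by move=> k; exact: C_k_sub Sc (Wsmooth c ac k).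
have sZ : smooth_on S Zc by apply: smooth_scale => //; exact: smooth_cst.
have gT x : S x -> (gc x)^T = gc x by move=> /Sc; exact: metric_sym.
have gpos x : S x -> forall v, v != 0 -> 0 < ip (gc x) v v by move=> /Sc; exact: metric_pos.
have KX : lie_killing S gc Xc by move=> x /Sc; exact: killing_lie.
have KZ : lie_killing S gc Zc.
  by apply: lie_killing_scale => // x /Sc; exact: (killing_lie hg ac hcurl).
have s_gt0 x : S x -> 0 < Num.sqrt (\det (gc x)).
  by move=> Sx; rewrite sqrtr_gt0 posdef_det_gt0 //; [exact: gT|exact: gpos].
have s_sqr x : S x -> Num.sqrt (\det (gc x)) ^+ 2 = \det (gc x).
  by move=> Sx; rewrite sqr_sqrtr // ltW // -sqrtr_gt0 s_gt0.
have dflat x : S x -> forall u v,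
    ('D_u (fun y => Xc y *m gc y) x *m v^T) 0 0 - ('D_v (fun y => Xc y *m gc y) x *m u^T) 0 0 =
    Num.sqrt (\det (gc x)) * det3 (2 *: Zc x) u v.
  move=> Sx u v; rewrite /Zc scalerA divff ?pnatr_eq0 // scale1r.
  by apply: curl_flat => //; [exact: Xsmooth|exact: Sc].
have indep x : S x -> forall a b, a *: Xc x + b *: Zc x = 0 -> a = 0 /\ b = 0.
  move=> Sx a b; rewrite /Zc scalerA => E.
  have [-> /eqP] := free_pair (hfree _ _ ac (chart_img_dom (Sc _ Sx)) (SU _ Sx)) E.
  by rewrite mulf_eq0 invr_eq0 pnatr_eq0 orbF => /eqP.
have [E [sE EP]] := killing_frame oS sgS sX sZ gT gpos KX KZ s_gt0 s_sqr dflat indep.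
have detE x : S x -> 0 < \det (E x) by case/EP.
have uE x : S x -> E x \in unitmx by move=> /detE d0; rewrite unitmxE unitfE gt_eqF.
have sB k : C_k k S (fun x => invmx (E x)) by exact: C_k_invmx (sE k).
(* The components of [F] are r, theta and z: primitives of the three columns of the inverse frame
   matrix, the dual coframe. *)
have [d [F [d0 dS dF]]] : exists d (F : 'rV[R]_3 -> 'rV[R]_3), [/\ 0 < d,
    ball (coord c p) d `<=` S &
    forall x v, ball (coord c p) d x -> is_derive x v F (v *m invmx (E x))].
  apply: (exists_primitive oS Sp (sB 1%N)) => x u v Sx.
  by apply: (closed_dual_coframe u v oS Sx uE (sE 1%N)); case: (EP x Sx).
have ob : open (ball (coord c p) d) by exact: ball_open.
have sF : smooth_on (ball (coord c p) d) F.
  by apply: (smooth_of_derive ob _ dF) => k; exact: C_k_sub dS (sB k).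
have uB x : ball (coord c p) d x -> invmx (E x) \in unitmx.
  by move=> /dS Sx; rewrite unitmx_inv uE.
(* The image of the new chart is a full ball, hence convex, as [radial_profile] requires. *)
have [W [G [e [[oW Wp] Wd e0 FG GF]]]] :=
  inverse_function ob (ballxx _ d0) (C_k_sub dS (sB 0%N)) dF uB.
set y0 := F (coord c p) in FG GF.
have WS : W `<=` S by move=> x /Wd/dS.
have oe : open (ball y0 e) by exact: ball_open.
have FG' x : W x -> ball y0 e (F x) /\ G (F x) = x by move=> /FG[? ->].
have GF' y : ball y0 e y -> W (G y) /\ F (G y) = y by move=> /GF[].
have GS y : ball y0 e y -> S (G y) by move=> /GF[/WS].
have DG y v : ball y0 e y -> 'D_v G y = v *m E (G y).
  by move=> /GF[_ _ _ ->]; rewrite invmxK.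
have dG y : ball y0 e y -> differentiable G y by move=> /GF[].
have sG : smooth_on (ball y0 e) G by exact: (smooth_inverse oe oS sE GS dG DG).
have DF x v : W x -> 'D_v F x = v *m invmx (E x).
  by move=> /Wd xd; rewrite (derive_val (is_derive := dF x v xd)).
pose psi := new_chart oW oe (subset_trans WS Sc) FG' GF' (fun k => C_k_sub Wd (sF k)) sG.
have apsi : atlas psi.
  by apply: (new_chart_atlas (E := E)) => // x Wx; exact/detE/WS.
exists psi; split=> //; first by move=> q [cq /WS /SU]; rewrite coordK.
pose h1 x := ip (gc x) (Xc x) (Xc x); pose h2 x := ip (gc x) (Xc x) (Zc x).
pose h3 x := ip (gc x) (Zc x) (Zc x).
have sh1 : smooth_on S h1 by exact: smooth_ip.
have sh2 : smooth_on S h2 by exact: smooth_ip.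
have dhG (h : 'rV[R]_3 -> R) y v : smooth_on S h -> ball y0 e y ->
    derivable (h \o G) y v /\ 'D_v (h \o G) y = 'D_(v *m E (G y)) h (G y).
  move=> sh ye; have dGy := dG y ye.
  have dh : differentiable h (G y) by apply: smooth_differentiable sh (GS y ye).
  have dhG : differentiable (h \o G) y by exact: differentiable_comp.
  split; first exact: diff_derivable.
  by rewrite (deriveE _ dhG) (diff_comp dGy dh) /= -(deriveE _ dGy) DG // -deriveE.
(* By [dhG] a derivative along [v] in the new coordinates is one along [v *m E], the form in which
   [killing_frame] supplies the derivatives. *)
have [a [phi [sphi phi_gt0 phiP]]] := @radial_profile R y0 e (h1 \o G) (h2 \o G)
  (fun y => Num.sqrt (h1 (G y) * h3 (G y) - h2 (G y) * h2 (G y))) e0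
  (fun k => C_k_comp oe oS GS (sG k) (sh1 k))
  (fun y ye => let: And5 _ _ _ _ (And4 h _ _ _) := EP _ (GS y ye) in h)
  (fun y v ye => etrans (proj2 (dhG h1 y v sh1 ye))
     (let: And5 _ _ _ _ (And4 _ _ h _) := EP _ (GS y ye) in h v))
  (fun y v ye => proj1 (dhG h2 y v sh2 ye))
  (fun y v ye => etrans (proj2 (dhG h2 y v sh2 ye))
     (let: And5 _ _ _ _ (And4 _ _ _ h) := EP _ (GS y ye) in h _)).
have rr : [set y 0 0 | y in chart_img psi] `<=` ball (y0 0 0) e.
  rewrite new_chart_img => _ [y ye <-]; move: ye; rewrite -!ball_normE /= => ye.
  by apply: le_lt_trans ye; have := ler_mx_entry (y0 - y) 0 0; rewrite !mxE.
exists a, phi; split=> [k|r /rr/phi_gt0//|q psiq r]; first exact: C_k_sub rr (sphi k).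
have [cq Wq] := psiq; have Sq := WS _ Wq; have [yq GFq] := FG' _ Wq.
have jq : jac c psi q = invmx (E (coord c q)) by exact: new_chart_jac.
have [[rX rZ] _ _ gramE [h1_gt0 gram_gt0 _ _]] := EP _ Sq.
have uq := uE _ Sq.
(* In the new chart the frame fields are the coordinate fields. *)
have e_row i : row i (E (coord c q)) *m invmx (E (coord c q)) = basis_vec R i.
  by rewrite -row_mul mulmxV // row1.
split.
- move=> v dr dtheta dz.
  have -> : inner g psi q v v =
      ip (gc (coord c q)) (v *m E (coord c q)) (v *m E (coord c q)).
    rewrite /gc coordK // (gtrans c psi q ac apsi cq psiq) jq /ip trmx_mul !mulmxA.
    have iE : (invmx (E (coord c q)))^T *m (E (coord c q))^T = 1%:M.
      by rewrite -trmx_mul mulmxV // trmx1.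
    by rewrite mulmxK // -[v *m _ *m _ *m _]mulmxA iE mulmx1.
  rewrite gramE -/(h1 _) -/(h2 _) -/(h3 _) -/dr -/dtheta -/dz.
  have [f2 h2a fk] := phiP _ yq.
  have f0 : phi r != 0 by rewrite gt_eqF //; apply/phi_gt0/rr; exists (coord psi q) => //; exact: coord_img.
  move: f2 h2a fk; rewrite /= GFq -/r => f2 h2a fk.
  have fk2 : (phi r * (phi^`())%classic r) ^+ 2 = h1 (coord c q) * h3 (coord c q) - a * a.
    by rewrite fk sqr_sqrtr; [rewrite h2a|exact: ltW].
  (* This gives a^2/phi^2 + phi'^2 = |Z|^2, the coefficient of dz^2; the other coefficients match
     through phi^2 = |X|^2 and phi (a/phi) = <X, Z>. *)
  have -> : (phi^`())%classic r ^+ 2 =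
      (h1 (coord c q) * h3 (coord c q) - a * a) / (phi r * phi r).
    by rewrite -fk2 exprMn expr2 mulrAC divff ?mul1r // mulf_neq0.
  by rewrite h2a -f2; field.
- rewrite (Xtrans c psi q ac apsi cq psiq) jq -(e_row 1) rX /Xc /= coordK //.
rewrite (Wtrans c psi q ac apsi cq psiq) jq -(e_row 2) rZ /Zc /= coordK //.
by rewrite -scalemxAl scalerA divff ?pnatr_eq0 // scale1r.
Qed.
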